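(* Let $d\ge 1$ and let $\boldsymbol{X}=(X_1,\ldots,X_d)^{\prime}\sim N_d(\boldsymbol{\mu},\tau^2\boldsymbol{\Sigma})$, where $\boldsymbol{\mu}=(\mu_1,\ldots,\mu_d)^{\prime}\in\mathbb{R}^d$ is unknown, $\boldsymbol{\Sigma}=((\sigma_{ij}))$ is a known (arbitrary) positive definite matrix, and $\tau^2>0$ is an unknown scalar. Let $V\sim\tau^2\chi_m^2$ independently of $\boldsymbol{X}$, where $m>0$ is a known number of degrees of freedom. Consider testing $H_i:\mu_i=0$ against $\mu_i\neq 0$ simultaneously for $i=1,\ldots,d$. Let $Z_i=X_i/\sqrt{\sigma_{ii}}$, $T_i=\sqrt{m}\,Z_i/\sqrt{V}$, let $P_i=\bar{\Psi}_{1,m}(T_i^2)$ be the two-sided $t$-test $p$-values, let $w_i=1-R_i^2$, where $R_i^2$ is the squared multiple correlation between $Z_i$ and $(Z_1,\ldots,Z_d)\setminus\{Z_i\}$, and let $$\tilde{P}_i=\bar{\Psi}_{1,m}\left(w_i^{-1}\,\bar{\Psi}_{1,m}^{-1}(P_i)\right),\qquad i=1,\ldots,d.$$ Let $\alpha\in(0,1)$ and let $\alpha_1\in(0,1)$ satisfy $$\sum_{i=1}^d\bar{\Psi}_{1,m}\left(w_i\,\bar{\Psi}_{1,m}^{-1}(\alpha_1)\right)=\alpha.$$ Then, for every $\boldsymbol{\mu}\in\mathbb{R}^d$ and every $\tau^2>0$, the false discovery rate of the BH (stepup) method applied to $\tilde{P}_1,\ldots,\tilde{P}_d$ with critical constants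 $i\alpha_1$, $i=1,\ldots,d$, is controlled at $\alpha$, i.e. $\mathrm{FDR}\le\alpha$.
   Context: $\bar{\Psi}_{m,n}=1-\Psi_{m,n}$, where $\Psi_{m,n}$ is the cdf of the central $F$ distribution with $m$ and $n$ degrees of freedom, and $\bar{\Psi}_{m,n}^{-1}$ is the inverse of $\bar{\Psi}_{m,n}$ on $(0,\infty)$. $\chi_m^2$ denotes the central chi-squared distribution with $m$ degrees of freedom. Squared multiple correlation: $R_i^2=\boldsymbol{\sigma}_{-i,i}^{\prime}\boldsymbol{\Sigma}_{-i,-i}^{-1}\boldsymbol{\sigma}_{-i,i}/\sigma_{ii}$, where $\boldsymbol{\Sigma}_{-i,-i}$ is $\boldsymbol{\Sigma}$ with its $i$th row and column removed and $\boldsymbol{\sigma}_{-i,i}$ is the $i$th column of $\boldsymbol{\Sigma}$ with its $i$th entry removed ($R_i^2=0$ if $d=1$). BH (stepup) method applied to statistics $\tilde{P}_1,\ldots,\tilde{P}_d$ with critical constants $\alpha_i=i\alpha_1$: with ordered values $\tilde{P}_{(1)}\le\cdots\le\tilde{P}_{(d)}$, let $R=\max\{1\le i\le d:\tilde{P}_{(i)}\le\alpha_i\}$; reject $H_i$ for every $i$ with $\tilde{P}_i\le\tilde{P}_{(R)}$ if the maximum exists, and reject no hypothesis otherwise (then $R=0$). False discovery rate: $\mathrm{FDR}=\mathbb{E}\left[\frac{V_0}{\max(R,1)}\right]$, where $R$ is the number of rejected null hypotheses and $V_0$ is the number of rejected null hypotheses $H_i$ that are true (i.e. with $\mu_i=0$).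 *)

(* Defs.v *)
From HB Require Import structures.
From mathcomp Require Import all_boot all_order all_algebra.
From mathcomp Require Import all_classical all_reals all_analysis.
From mathcomp Require Import measurable_realfun.

Set Implicit Arguments.
Unset Strict Implicit.
Unset Printing Implicit Defensive.

Import Order.TTheory GRing.Theory Num.Theory.
Import numFieldNormedType.Exports.

Local Open Scope classical_set_scope.
Local Open Scope ring_scope.

Definition posdef (R : realType) (d : nat) (S : 'M[R]_d) : Prop :=
  S^T = S /\ forall v : 'cV[R]_d, v != 0 -> 0 < (v^T *m S *m v) 0 0.

(* [lebesgue_measure] is declared on [measurableTypeR R]; this copy lives on [R]
   with its default display, which is the one [n.-tuple R] is built from. *)
Section lebesgue_R.
Context (R : realType).

Definition lebesgue_R : set R -> \bar R := @lebesgue_measure R.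

Let leb0 : lebesgue_R set0 = 0%E.
Proof. exact: (measure0 (@lebesgue_measure R)). Qed.

Let leb_ge0 A : (0 <= lebesgue_R A)%E.
Proof. exact: (measure_ge0 (@lebesgue_measure R)). Qed.

Let leb_additive : semi_sigma_additive lebesgue_R.
Proof. exact: (@measure_semi_sigma_additive _ _ _ (@lebesgue_measure R)). Qed.

HB.instance Definition _ := isMeasure.Build _ _ _ lebesgue_R
  leb0 leb_ge0 leb_additive.

Let leb_sigma_finite : sigma_finite [set: R] lebesgue_R.
Proof. exact: (@sigma_finiteT _ _ _ (@lebesgue_measure R)). Qed.

HB.instance Definition _ := Measure_isSigmaFinite.Build _ _ _ lebesgue_R
  leb_sigma_finite.

End lebesgue_R.

Section cons_lebesgue.
Context (R : realType) (n : nat).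
Variable mu : {sigma_finite_measure set (n.-tuple R) -> \bar R}.

Definition cons_pair (z : R * n.-tuple R) : n.+1.-tuple R :=
  [the n.+1.-tuple R of z.1 :: z.2].

Lemma measurable_cons_pair : measurable_fun [set: R * n.-tuple R] cons_pair.
Proof. exact: measurable_cons. Qed.

Definition cons_lebesgue : set (n.+1.-tuple R) -> \bar R :=
  pushforward (@lebesgue_R R \x mu)%E cons_pair.

Let pre A : measurable A -> measurable (cons_pair @^-1` A).
Proof. by move=> mA; rewrite -[X in measurable X]setTI; exact: measurable_cons_pair. Qed.

Let cons0 : cons_lebesgue set0 = 0%E.
Proof. by rewrite /cons_lebesgue /pushforward preimage_set0 measure0. Qed.

Let cons_ge0 A : (0 <= cons_lebesgue A)%E.
Proof.
rewrite /cons_lebesgue /pushforward.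
exact: (measure_ge0 (@lebesgue_R R \x mu)%E).
Qed.

Let cons_additive : semi_sigma_additive cons_lebesgue.
Proof.
move=> F mF tF mUF; rewrite /cons_lebesgue /pushforward preimage_bigcup.
apply: measure_semi_sigma_additive.
- by move=> k; exact: pre.
- apply/trivIsetP => /= i j _ _ ij; rewrite -preimage_setI.
  by move/trivIsetP : tF => /(_ _ _ _ _ ij) ->//; rewrite preimage_set0.
- by rewrite -preimage_bigcup; exact: pre.
Qed.

HB.instance Definition _ := isMeasure.Build _ _ _ cons_lebesgue
  cons0 cons_ge0 cons_additive.

Let cons_sigma_finite : sigma_finite [set: n.+1.-tuple R] cons_lebesgue.
Proof.
have /sigma_finiteP[F [TF ndF Foo]] := sigma_finiteT (@lebesgue_R R).
have /sigma_finiteP[G [TG ndG Goo]] := sigma_finiteT mu.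
pose g (t : n.+1.-tuple R) : R * n.-tuple R := (thead t, [tuple of behead t]).
have mg : measurable_fun [set: n.+1.-tuple R] g.
  exact: (measurable_fun_pair (measurable_tnth _) (@measurable_behead _ _ _)).
have gK : g \o cons_pair = id.
  by apply/funext => -[x t] /=; congr pair; exact/val_inj.
exists (fun k => g @^-1` (F k `*` G k)).
  rewrite -preimage_bigcup -[LHS](preimage_setT g); congr (_ @^-1` _).
  rewrite -setXTT TF TG predeqE => -[x y]; split.
    move=> [/= [k _ Fkx] [l _ Gly]]; exists (maxn k l) => //; split.
    - by move: x Fkx; exact/subsetPset/ndF/leq_maxl.
    - by move: y Gly; exact/subsetPset/ndG/leq_maxr.
  by move=> [k _ []/= ? ?]; split; exists k.
move=> k; have [mF fF] := Foo k; have [mG fG] := Goo k; split.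
  by rewrite -[X in measurable X]setTI; apply: mg => //; exact: measurableX.
rewrite /cons_lebesgue /pushforward -comp_preimage gK preimage_id.
by rewrite product_measure1E// lte_mul_pinfty// ge0_fin_numE.
Qed.

HB.instance Definition _ := Measure_isSigmaFinite.Build _ _ _ cons_lebesgue
  cons_sigma_finite.

End cons_lebesgue.

Fixpoint lebesgue_tuple (R : realType) (n : nat) :
    {sigma_finite_measure set (n.-tuple R) -> \bar R} :=
  if n is k.+1 then cons_lebesgue (lebesgue_tuple R k) else \d_[tuple].

(* Meaningful for positive definite S, where N_d(mu, S) has a density. *)
Definition mvnormal_pdf (R : realType) (d : nat) (mu : 'cV[R]_d) (S : 'M[R]_d)
    (x : d.-tuple R) : R :=
  let y := \col_i tnth x i - mu in
  expR (- (y^T *m invmx S *m y) 0 0 / 2) / Num.sqrt ((2 * pi) ^+ d * \det S).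

Definition mvnormal_dist (R : realType) (d : nat) (mu : 'cV[R]_d) (S : 'M[R]_d)
    : set (d.-tuple R) -> \bar R :=
  fun B => (\int[lebesgue_tuple R d]_(x in B) (mvnormal_pdf mu S x)%:E)%E.

Definition Gamma (R : realType) (a : R) : R :=
  \int[lebesgue_measure]_(x in `]0, +oo[) (x `^ (a - 1) * expR (- x)).

(* k > 0 is real: degrees of freedom need not be integers. *)
Definition chi2_pdf (R : realType) (k x : R) : R :=
  if 0 < x then
    x `^ (k / 2 - 1) * expR (- x / 2) / (2 `^ (k / 2) * Gamma (k / 2))
  else 0.

Definition chi2_dist (R : realType) (k : R) : set R -> \bar R :=
  fun A => (\int[lebesgue_measure]_(x in A) (chi2_pdf k x)%:E)%E.

Section chi2_measure.
Context (R : realType) (k : R).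

Lemma chi2_pdf_ge0 (x : R) : 0 <= chi2_pdf k x.
Proof.
rewrite /chi2_pdf; case: ifPn => // x0.
rewrite divr_ge0 ?mulr_ge0 ?powR_ge0 ?expR_ge0//.
by apply: Rintegral_ge0 => y _; rewrite mulr_ge0 ?powR_ge0 ?expR_ge0.
Qed.

Lemma measurable_chi2_pdf : measurable_fun [set: R] (chi2_pdf k).
Proof.
apply: measurable_fun_ifT => //=.
- exact: measurable_fun_ltr.
- apply: measurable_funM => //; apply: measurable_funM => //.
  by apply: measurableT_comp => //; exact: measurable_funM.
Qed.

Let chi2_0 : chi2_dist k set0 = 0%E.
Proof. exact: integral_set0. Qed.

Let chi2_ge0 A : (0 <= chi2_dist k A)%E.
Proof. by apply: integral_ge0 => x _; rewrite lee_fin chi2_pdf_ge0. Qed.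

Let chi2_additive : semi_sigma_additive (chi2_dist k).
Proof.
move=> /= F mF tF mUF; rewrite /chi2_dist; apply: cvg_toP.
  apply: ereal_nondecreasing_is_cvgn => m n mn.
  apply: lee_sum_nneg_natr => // j _ _; apply: integral_ge0 => /= x _.
  by rewrite lee_fin chi2_pdf_ge0.
rewrite ge0_integral_bigcup//=.
- by apply/measurable_funTS/measurableT_comp => //; exact: measurable_chi2_pdf.
- by move=> x _; rewrite lee_fin chi2_pdf_ge0.
Qed.

HB.instance Definition _ := isMeasure.Build _ _ _ (chi2_dist k)
  chi2_0 chi2_ge0 chi2_additive.

End chi2_measure.

(* The law of (U / a) / (W / b) for independent U ~ chi2_a and W ~ chi2_b. *)
Definition F_dist (R : realType) (a b : R) : set R -> \bar R :=
  pushforward (chi2_dist a \x chi2_dist b)%E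
    (fun z : R * R => (z.1 / a) / (z.2 / b)).

Definition Psi (R : realType) (a b x : R) : R := fine (F_dist a b `]-oo, x]).

Definition Psibar (R : realType) (a b x : R) : R := 1 - Psi a b x.

(* Takes the value 0 outside the image of ]0, +oo[ under Psibar, in particular
   at 1 = Psibar 0. *)
Definition Psibar_inv (R : realType) (a b : R) : R -> R :=
  'pinv_(fun=> 0) `]0, +oo[ (Psibar a b).

(* For d = 1 the matrices are empty and the value is 0. *)
Definition multiple_corr2 (R : realType) (d : nat) (S : 'M[R]_d) (i : 'I_d) : R :=
  let s := row' i (col i S) in
  (s^T *m invmx (row' i (col' i S)) *m s) 0 0 / S i i.

Definition independent_rv (dT d1 d2 : measure_display)
    (T : measurableType dT) (T1 : measurableType d1) (T2 : measurableType d2)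
    (R : realType) (P : probability T R)
    (X : {RV P >-> T1}) (Y : {RV P >-> T2}) : Prop :=
  forall (A : set T1) (B : set T2), measurable A -> measurable B ->
    P (X @^-1` A `&` Y @^-1` B) = (P (X @^-1` A) * P (Y @^-1` B))%E.

(* Order statistics are indexed from 1. *)
Definition order_stat (R : realType) (d : nat) (p : 'I_d -> R) (k : nat) : R :=
  nth 0 (sort <=%R (codom p)) k.-1.

(* The largest 1 <= k <= d with P_(k) <= c k; 0 when there is none. *)
Definition stepup_index (R : realType) (d : nat) (c : nat -> R) (p : 'I_d -> R)
    : nat :=
  (\max_(1 <= k < d.+1 | (order_stat p k <= c k)%R) k)%N.

Definition stepup_reject (R : realType) (d : nat) (c : nat -> R)
    (p : 'I_d -> R) : {set 'I_d} :=
  let r := stepup_index c p in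
  if r == 0%N then finset.set0 else [set i | p i <= order_stat p r]%SET.

(* E[V_0 / max(R, 1)], where H0 is the set of true null hypotheses. *)
Definition FDR (dT : measure_display) (T : measurableType dT) (R : realType)
    (P : probability T R) (d : nat) (H0 : {set 'I_d}) (rej : T -> {set 'I_d})
    : \bar R :=
  'E_P[fun omega => #|(rej omega :&: H0)%SET|%:R / (maxn #|rej omega| 1)%:R].

(* Main.v *)
Require Import Defs.
From HB Require Import structures.
From mathcomp Require Import all_boot all_order all_algebra.
From mathcomp Require Import all_classical all_reals all_analysis.
From mathcomp Require Import measurable_realfun ring lra.

Set Implicit Arguments.
Unset Strict Implicit.
Unset Printing Implicit Defensive.

Import Order.TTheory GRing.Theory Num.Theory.
Import numFieldNormedType.Exports.

Local Open Scope classical_set_scope.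
Local Open Scope ring_scope.

(** Let [q] be the two-sided t p-value as a function of the squared statistic
    and [O = Sigma^-1]. Since [O_ii * sigma_ii * (1 - R_i^2) = 1], the adjusted
    p-value is [q (m * X_i^2 * O_ii / V)]: the weight replaces the marginal
    variance of [X_i] by its variance given the other coordinates.

    The contribution of a true null to the FDR is at most
    [E (1{p_i <= r_i * a} / r_i)], where the leave-one-out count [r_i] is a
    function of [V] and the [X_j] with [j <> i], nonincreasing in [V]. Given those
    [X_j], the standardized [X_i] is [N(theta, 1)] for some [theta]. With
    [b = u / sqrt w] and [s = w * (1 + b^2)] in place of [X_i] and [V], the
    p-value depends on [b] alone, while for fixed [s] both [r_i] and the
    likelihood ratio of [b] to the central law, which after symmetrization is a
    [cosh], are nondecreasing in [b^2]. The average of the likelihood ratio over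
    [p_i <= k * a] is then nonincreasing in [k], so the conditional expectation
    is at most the conditional probability of [p_i <= a]. Integrating back and
    using [mu_i = 0], the i-th term is at most [q (w_i * q^-1 a)]. *)

(** * Lebesgue integrals *)

(** The common scale [V] is the obstacle: the other p-values move with it, so they cannot be fixed
    while [p_i] varies. Given the other [X_j] and [V], the count [r_i] would be constant, but the
    bound [P(p_i <= u) <= u] would then fail in general, even in the central case. The variable [s]
    is chosen because it is independent of [b] under the central law. Fixing [s] leaves that bound
    intact and makes the p-value, the count and the likelihood ratio functions of the single
    variable [b].

    Even for a true null [theta] is usually nonzero, because it contains the regression of [X_i] on
    the other coordinates. The conditional comparison is therefore with the probability of
    [p_i <= a], not with [a]. That probability is evaluated only after averaging over the other
    coordinates, when [X_i] has mean 0 and a variance larger than the conditional one by the factor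
    [1 / w_i].

    The constants of the Student and multivariate normal densities are never evaluated: total masses
    are read off from the laws of [X] and [V] being probabilities. *)

Section integral_generalities.
Context d (T : measurableType d) (R : realType).
Local Open Scope ereal_scope.
Import HBNNSimple.

(** The integral of a nonnegative function is a supremum over the simple functions below it, so
    monotonicity needs no measurability. This serves for the false discovery proportion and for
    integrands that are themselves integrals. *)
Lemma ge0_le_integral_nonmeas (mu : {measure set T -> \bar R})
    (f1 f2 : T -> \bar R) :
  (forall x, 0 <= f1 x) -> (forall x, f1 x <= f2 x) ->
  \int[mu]_x f1 x <= \int[mu]_x f2 x.
Proof.
move=> f10 f12; rewrite !ge0_integralTE//; last first.
  by move=> x; exact: le_trans (f12 x).
apply: le_ereal_sup => _ [h hf1 <-]; exists h => // x.
exact: le_trans (hf1 x) (f12 x).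
Qed.

(** Only the values of [nu] on measurable sets enter, so this applies to laws known through a
    formula, such as [distribution P X] or [chi2_dist m], as well as to measures built from a
    density. *)
Lemma ge0_integral_density (nu mu : {measure set T -> \bar R}) (f : T -> R)
    (g : T -> \bar R) :
  measurable_fun [set: T] f -> (forall x, (0 <= f x)%R) ->
  (forall A, measurable A -> nu A = \int[mu]_(x in A) (f x)%:E) ->
  measurable_fun [set: T] g -> (forall x, 0 <= g x) ->
  \int[nu]_x g x = \int[mu]_x (g x * (f x)%:E).
Proof.
move=> mf f0 nuE mg g0.
have mfE : measurable_fun [set: T] (EFin \o f) by exact/measurable_EFinP.
pose h := nnsfun_approx measurableT mg.
have hE (x : T) : (h n x)%:E @[n --> \oo] --> g x by exact: cvg_nnsfun_approx.
have hnd (x : T) : {homo (fun n => (h n x)%:E) : m n / (m <= n)%N >-> m <= n}.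
  by move=> m n mn; rewrite lee_fin; exact/lefP/nd_nnsfun_approx.
transitivity (limn (fun n => \int[nu]_x (h n x)%:E)).
  rewrite -monotone_convergence//.
  - by apply: eq_integral => x _; apply/esym/cvg_lim.
  - by move=> n; exact/measurable_EFinP.
  - by move=> n x _; rewrite lee_fin.
transitivity (limn (fun n => \int[mu]_x ((h n x)%:E * (f x)%:E))); last first.
  rewrite -monotone_convergence//.
  - apply: eq_integral => x _; apply/cvg_lim => //.
    by apply: cvgeZr => //; exact: hE.
  - by move=> n; apply: emeasurable_funM => //; exact/measurable_EFinP.
  - by move=> n x _; rewrite mule_ge0// lee_fin.
  - by move=> x _ m n mn; rewrite lee_wpmul2r ?lee_fin//; exact: hnd.
congr (limn _); apply/funext => n.
have hr r x : 0 <= (r * \1_(h n @^-1` [set r]) x)%:E.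
  by rewrite EFinM nnfun_muleindic_ge0.
under eq_integral do rewrite fimfunE -fsumEFin//.
rewrite ge0_integral_fsum//; last first.
  by move=> r; exact/measurable_EFinP/measurable_funM.
transitivity (\int[mu]_x \sum_(r \in range (h n))
    ((r * \1_(h n @^-1` [set r]) x)%:E * (f x)%:E)); last first.
  apply: eq_integral => x _; rewrite [in RHS]fimfunE -fsumEFin//.
  by rewrite ge0_mule_fsuml.
rewrite ge0_integral_fsum//; last 2 first.
- move=> r; apply: emeasurable_funM => //.
  exact/measurable_EFinP/measurable_funM.
- by move=> r x _; rewrite mule_ge0 ?lee_fin//; exact: hr.
apply: eq_fsbigr => r _.
rewrite integralZl_indic_nnsfun// integral_indic// setIT nuE//.
have [r0|r0] := leP 0%R r; last first.
  rewrite preimage_nnfun0// integral_set0 mule0.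
  by rewrite integral0_eq// => x _; rewrite indic0 mulr0 mul0e.
rewrite -ge0_integralZl//; last 2 first.
  exact: measurable_funTS.
  by move=> x _; rewrite lee_fin.
rewrite integral_mkcond; apply: eq_integral => x _.
rewrite patchE/= indicE; case: ifPn => xr; rewrite ?mulr1// mulr0 mul0e//.
Qed.

End integral_generalities.

(** * Changes of variables for Lebesgue measure *)

Section affine_change.
Context (R : realType).
Local Open Scope ereal_scope.
Local Notation L := (@lebesgue_R R).

(** The identity, read as a map between the two measurable structures on [R], pushes one copy of
    Lebesgue measure to the other. *)
Lemma ge0_integral_lebesgue_R (f : R -> \bar R) (D : set R) : measurable D ->
  measurable_fun D f -> (forall x, D x -> 0 <= f x) ->
  \int[lebesgue_measure]_(x in D) f x = \int[L]_(x in D) f x.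
Proof.
move=> mD mf f0.
have mid : measurable_fun [set: measurableTypeR R]
  (fun x : measurableTypeR R => x : R) by [].
have := @ge0_integral_pushforward _ _ (measurableTypeR R) R R _ mid
  (@lebesgue_measure R) D f mD mf.
rewrite preimage_id => <- //; last by move=> x /set_mem; exact: f0.
Qed.

Section affine.
Variables (a b : R).
Hypothesis a0 : (0 < a)%R.
Let phi (x : R) : R := (a * x + b)%R.
Let mphi : measurable_fun [set: measurableTypeR R]
  (phi : measurableTypeR R -> measurableTypeR R).
Proof. by apply: measurable_funD => //; exact: measurable_funM. Qed.

(** Both sides are measures in [A] that agree on half-open intervals, which determines Lebesgue
    measure. Positivity of [a] keeps []c, e]] of the same type under preimage. *)
Lemma lebesgue_affine (A : set R) : measurable A ->
  L A = a%:E * L (phi @^-1` A).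
Proof.
move=> mA.
have := @lebesgue_measure_unique R
  (mscale (NngNum (ltW a0)) (pushforward (@lebesgue_measure R) (phi : measurableTypeR R -> measurableTypeR R))).
apply => // _ [[c e]] _ <-.
have phiE : phi @^-1` `]c, e] = `]((c - b) / a)%R, ((e - b) / a)%R]%classic.
  apply/seteqP; split => x /=; rewrite !in_itv/= /phi;
    by rewrite ltr_pdivrMr// ler_pdivlMr// ltrBlDr lerBrDr (mulrC x).
transitivity (a%:E * lebesgue_measure (phi @^-1` `]c, e])); last by [].
rewrite phiE !lebesgue_measure_itv/= !lte_fin.
rewrite ltr_pM2r ?invr_gt0// ltrD2r; case: ifP => _; last by rewrite mule0.
rewrite -EFinB -EFinM -mulrBl; congr (_%:E).
by rewrite mulrC divfK ?gt_eqF// opprB addrA subrK.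
Qed.

Lemma ge0_integral_affine (f : R -> \bar R) :
  measurable_fun [set: R] f -> (forall x, 0 <= f x) ->
  \int[L]_x f x = a%:E * \int[L]_x f (a * x + b)%R.
Proof.
move=> mf f0.
have mpsi : measurable_fun [set: R] (fun x : R => a * x + b)%R.
  by apply: measurable_funD => //; exact: measurable_funM.
pose psi (x : R) : R := (a * x + b)%R.
have -> : \int[L]_x f x =
    \int[mscale (NngNum (ltW a0)) (pushforward L psi)]_x f x.
  by move=> m; apply: eq_measure_integral => A mA _; exact: lebesgue_affine.
rewrite ge0_integral_mscale//.
congr (_ * _); rewrite ge0_integral_pushforward//.
Qed.

End affine.

Lemma ge0_integral_opp (f : R -> \bar R) :
  measurable_fun [set: R] f -> (forall x, 0 <= f x) ->
  \int[L]_x f x = \int[L]_x f (- x)%R.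
Proof.
move=> mf f0.
have mN : measurable_fun [set: R] (-%R : R -> R) by [].
transitivity (\int[pushforward L (-%R : R -> R)]_x f x).
  apply: eq_measure_integral => A mA _.
  exact/esym/lebesgue_measureN.
by rewrite ge0_integral_pushforward.
Qed.

End affine_change.

Section density_measure.
Context d (T : measurableType d) (R : realType).
Variables (mu : {measure set T -> \bar R}) (f : T -> R).
Hypothesis mf : measurable_fun [set: T] f.
Hypothesis f0 : forall x, 0 <= f x.
Local Open Scope ereal_scope.

Definition density (A : set T) : \bar R := \int[mu]_(x in A) (f x)%:E.

Let density_0 : density set0 = 0.
Proof. exact: integral_set0. Qed.

Let density_ge0 A : 0 <= density A.
Proof. by apply: integral_ge0 => x _; rewrite lee_fin. Qed.

Let density_additive : semi_sigma_additive density.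
Proof.
move=> /= F mF tF mUF; rewrite /density; apply: cvg_toP.
  apply: ereal_nondecreasing_is_cvgn => m n mn.
  apply: lee_sum_nneg_natr => // j _ _; apply: integral_ge0 => /= x _.
  by rewrite lee_fin.
rewrite ge0_integral_bigcup//=.
- by apply/measurable_funTS/measurableT_comp.
- by move=> x _; rewrite lee_fin.
Qed.

HB.instance Definition _ := isMeasure.Build _ _ _ density
  density_0 density_ge0 density_additive.

Definition density_measure : {measure set T -> \bar R} := density.

Lemma ge0_integral_density_measure (g : T -> \bar R) :
  measurable_fun [set: T] g -> (forall x, 0 <= g x) ->
  \int[density_measure]_x g x = \int[mu]_x (g x * (f x)%:E).
Proof. exact: ge0_integral_density. Qed.

End density_measure.

Section signed_square.
Context (R : realType).
Local Notation L := (@lebesgue_R R).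

(** Unlike the square, this is an increasing bijection of the whole line, so preimages of half-open
    intervals are half-open intervals and uniqueness of Lebesgue measure applies. It agrees with the
    square on the positive half-line. *)
Definition signed_sqr (u : R) : R := u * `|u|.

Lemma signed_sqr_ltP (x y : R) : (signed_sqr x < signed_sqr y) = (x < y).
Proof.
rewrite /signed_sqr; have [x0|x0] := lerP 0 x; have [y0|y0] := lerP 0 y.
- by rewrite !ger0_norm// -!expr2 ltr_pXn2r ?nnegrE.
- rewrite (ger0_norm x0) (ltr0_norm y0).
  rewrite [RHS]lt_gtF ?(lt_le_trans y0)//; apply/negbTE; rewrite -leNgt.
  nra.
- rewrite (ltr0_norm x0) (ger0_norm y0) [RHS](lt_le_trans x0)//.
  nra.
- rewrite (ltr0_norm x0) (ltr0_norm y0) !mulrN ltrN2 -!expr2 -sqrrN -(sqrrN x).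
  by rewrite ltr_pXn2r ?nnegrE ?oppr_ge0 ?ltW// ltrN2.
Qed.

Lemma signed_sqr_surj (c : R) : exists x, signed_sqr x = c.
Proof.
exists (Num.sg c * Num.sqrt `|c|); rewrite /signed_sqr normrM.
rewrite (ger0_norm (sqrtr_ge0 _)) normr_sg mulrACA -expr2 sqr_sqrtr//.
have [->|c0] := eqVneq c 0; first by rewrite normr0 mulr0.
by rewrite mulr1 mulr_sg_norm.
Qed.

Lemma is_derive_signed_sqr (x : R) : is_derive x 1 signed_sqr (2 * `|x|).
Proof.
have sqd (y : R) : is_derive y 1 (fun u : R => u * u) (2 * y).
  apply: is_derive_eq; by rewrite /GRing.scale/= !mulr1 mulr_natl mulr2n.
have [x0|x0|<-] := ltrgtP 0 x.
- rewrite ger0_norm 1?ltW//; apply: near_eq_is_derive (sqd x).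
  near=> y; rewrite /signed_sqr ger0_norm// ltW//; near: y.
  exact: lt_nbhsr.
- rewrite ltr0_norm// mulrN; have := is_deriveN (sqd x).
  apply: near_eq_is_derive; near=> y.
  rewrite /signed_sqr ltr0_norm ?mulrN//; near: y.
  exact: lt_nbhsl.
- rewrite normr0 mulr0.
  (* At 0 the difference quotient is [|h|]. *)
  have c0 : h^-1 *: ((signed_sqr \o shift 0) (h *: 1) - signed_sqr 0)
      @[h --> (0:R)^'] --> (0:R).
    have n0 : `|h| @[h --> (0:R)^'] --> (0:R).
      rewrite -[X in _ --> X](@normr0 _ R).
      by apply: cvg_norm; exact: nbhs_dnbhs.
    apply: cvg_trans n0; apply: near_eq_cvg; near=> h.
    rewrite /signed_sqr/= /GRing.scale/= addr0 mul0r subr0 mulr1 mulrA mulVf ?mul1r//.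
    by near: h; exact: nbhs_dnbhs_neq.
  by apply: DeriveDef; [apply: cvgP c0|apply: cvg_lim c0].
Unshelve. all: by end_near. Qed.

Lemma continuous_signed_sqr : continuous signed_sqr.
Proof.
by move=> x; apply: continuousM; [exact: cvg_id|exact: norm_continuous].
Qed.

Lemma measurable_signed_sqr : measurable_fun [set: R] signed_sqr.
Proof. exact: continuous_measurable_fun continuous_signed_sqr. Qed.

Lemma integral_norm_signed_sqr (a b : R) : a < b ->
  (\int[lebesgue_measure]_(x in `]a, b]) (2 * `|x|)%:E =
    (signed_sqr b - signed_sqr a)%:E)%E.
Proof.
move=> ab.
have cnorm : continuous (fun x : R => 2 * `|x|).
  by move=> x; apply: cvgM; [exact: cvg_cst|exact: norm_continuous].
rewrite integral_itv_obnd_cbnd.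
  rewrite (@continuous_FTC2 _ _ signed_sqr)//.
  - exact: continuous_subspaceT.
  - split => [x _||].
    + by have [] := is_derive_signed_sqr x.
    + by apply: cvg_at_right_filter; exact: continuous_signed_sqr.
    + by apply: cvg_at_left_filter; exact: continuous_signed_sqr.
  - by move=> x _; rewrite derive1E; have [] := is_derive_signed_sqr x.
apply/measurable_EFinP; apply: measurable_funTS; apply: measurable_funM => //.
Qed.

Let dabs (u : R) : R := 2 * `|u|.
Let dabs0 u : 0 <= dabs u. Proof. by rewrite mulr_ge0. Qed.
Let mdabs : measurable_fun [set: measurableTypeR R] (dabs : measurableTypeR R -> R).
Proof. exact: measurable_funM. Qed.
Let mss : measurable_fun [set: measurableTypeR R]
  (signed_sqr : measurableTypeR R -> measurableTypeR R).
Proof. exact: measurable_signed_sqr. Qed.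

Local Open Scope ereal_scope.

(** By uniqueness of Lebesgue measure it suffices to test half-open intervals, where the fundamental
    theorem of calculus applies with the derivative [2 * |u|]. *)
Lemma lebesgue_signed_sqr (A : set R) : measurable A ->
  L A = \int[lebesgue_measure]_(u in signed_sqr @^-1` A) (dabs u)%:E.
Proof.
move=> mA.
have := @lebesgue_measure_unique R
  (pushforward (density lebesgue_measure dabs) (signed_sqr : measurableTypeR R -> measurableTypeR R)).
apply => // _ [[a b] _ <-].
have [x xa] := signed_sqr_surj a; have [y yb] := signed_sqr_surj b.
have phiE : signed_sqr @^-1` `]a, b] = `]x, y]%classic.
  apply/seteqP; split => z /=; rewrite !in_itv/= -xa -yb;
  by rewrite !leNgt !signed_sqr_ltP.
transitivity (\int[lebesgue_measure]_(u in signed_sqr @^-1` `]a, b]) (dabs u)%:E); last by [].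
rewrite phiE lebesgue_measure_itv/= lte_fin -xa -yb signed_sqr_ltP.
case: ifPn => xy; first by rewrite integral_norm_signed_sqr.
by rewrite set_itv_ge ?integral_set0// bnd_simp.
Qed.

Lemma ge0_integral_signed_sqr (f : R -> \bar R) :
  measurable_fun [set: R] f -> (forall x, 0 <= f x) ->
  \int[L]_x f x = \int[L]_u (f (signed_sqr u) * (2 * `|u|)%:E).
Proof.
move=> mf f0.
have mdR : measurable_fun [set: R] dabs by exact: measurable_funM.
transitivity (\int[pushforward (density L dabs) signed_sqr]_x f x).
  apply: eq_measure_integral => A mA _.
  rewrite /= lebesgue_signed_sqr// ge0_integral_lebesgue_R//.
  - rewrite -[X in measurable X]setTI; exact: measurable_signed_sqr.
  - by apply/measurable_EFinP; exact: measurable_funTS.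
  - by move=> x _; rewrite lee_fin.
rewrite ge0_integral_pushforward//.
rewrite (@ge0_integral_density _ _ _ _ L dabs)//; last first.
  by move=> x; exact: f0.
by apply: measurableT_comp => //; exact: measurable_signed_sqr.
Qed.

Lemma ge0_integral_even (k : R -> \bar R) :
  measurable_fun [set: R] k -> (forall x, 0 <= k x) ->
  (forall x, k (- x)%R = k x) ->
  \int[L]_u k u = \int[L]_u (if (0 < u)%R then 2%:E * k u else 0).
Proof.
move=> mk k0 kN.
pose p (u : R) := if (0 < u)%R then k u else 0.
have mp : measurable_fun [set: R] p.
  by apply: measurable_fun_ifT => //; exact: measurable_fun_ltr.
have p0 u : 0 <= p u by rewrite /p; case: ifP.
have -> : \int[L]_u k u = \int[L]_u (p u + p (- u)%R).
  apply: ge0_ae_eq_integral => //.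
  - by apply: emeasurable_funD => //; exact: measurableT_comp.
  - by move=> u _; rewrite adde_ge0.
  - exists [set 0%R]; split; [exact: measurable_set1|exact: lebesgue_measure_set1|].
    move=> u /= uN; apply: contrapT => u0; apply: uN => _.
    rewrite /p kN oppr_gt0; case: (ltgtP u 0%R) => // _.
    + by rewrite add0e.
    + by rewrite adde0.
rewrite ge0_integralD//; last exact: measurableT_comp.
rewrite -ge0_integral_opp// -mule2n -mule_natl -ge0_integralZl//.
by apply: eq_integral => u _; rewrite /p; case: ifP; rewrite ?mule0.
Qed.

(** For [z = u ^+ 2] with [u > 0] the Jacobian [2 * u] cancels [z ^ (-1/2)] up to a factor 2, which
    evenness in [u] absorbs by extending the integral to the whole line. The power [2^-1 - 1] is the
    one in the integrand of [Gamma (1/2)] and in the [chi2_1] density. *)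
Lemma ge0_integral_sqr (g : R -> \bar R) :
  measurable_fun [set: R] g -> (forall x, 0 <= g x) ->
  \int[L]_z (if (0 < z)%R then g z * (z `^ (2^-1 - 1))%:E else 0) =
  \int[L]_u g (u ^+ 2)%R.
Proof.
move=> mg g0.
rewrite ge0_integral_signed_sqr; last 2 first.
- apply: measurable_fun_ifT => //; first exact: measurable_fun_ltr.
  by apply: emeasurable_funM => //; apply: measurableT_comp => //; exact: measurable_powR.
- by move=> z; case: ifP => // _; rewrite mule_ge0// lee_fin powR_ge0.
rewrite [RHS]ge0_integral_even//; last 2 first.
- by apply: measurableT_comp => //; exact: measurable_funX.
- by move=> u; rewrite sqrrN.
apply: eq_integral => u _; rewrite /signed_sqr.
have [u0|u0] := ltP 0%R u; last first.
  by rewrite ifF ?mul0e//; apply/negbTE; rewrite -leNgt mulr_le0_ge0.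
rewrite ger0_norm 1?ltW// -expr2 exprn_gt0//.
rewrite -muleA -EFinM muleC; congr (_%:E * _).
rewrite -powR_mulrn 1?ltW// -powRrM mulrBr mulr1 mulfV//.
have -> : (1 - 2 = -1 :> R)%R by lra.
by rewrite powR_inv1 1?ltW// mulrCA mulVf ?gt_eqF// mulr1.
Qed.

Lemma Gamma_half : Gamma (2^-1 : R) = Num.sqrt pi.
Proof.
rewrite /Gamma /Rintegral.
rewrite ge0_integral_lebesgue_R//; last 2 first.
- apply: measurableT_comp => //; apply: measurable_funTS; apply: measurable_funM => //.
  exact: measurableT_comp.
- by move=> x _; rewrite lee_fin mulr_ge0 ?powR_ge0 ?expR_ge0.
rewrite integral_mkcond.
have mexp : measurable_fun [set: R] (fun z : R => (expR (- z))%:E).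
  by apply: measurableT_comp => //; exact: measurableT_comp.
have gaussE : \int[L]_u (expR (- u ^+ 2))%:E = (Num.sqrt pi)%:E.
  rewrite -ge0_integral_lebesgue_R//; first exact: integralT_gauss.
  by apply: measurableT_comp mexp _; exact: measurable_funX.
rewrite -[RHS]/(fine (Num.sqrt pi)%:E) -gaussE.
rewrite -(ge0_integral_sqr mexp); last by move=> x; rewrite lee_fin expR_ge0.
congr fine; apply: eq_integral => x _.
rewrite patchE mem_setE in_itv/= andbT; case: ifPn => // _.
by rewrite -EFinM mulrC.
Qed.

(** The square of a standard normal variable is [chi2_1]. This is the link between the F
    distribution of the statement and two-sided t-tests. *)
Lemma ge0_integral_chi2_1 (g : R -> \bar R) :
  measurable_fun [set: R] g -> (forall x, 0 <= g x) ->
  \int[L]_z (g z * (chi2_pdf 1 z)%:E) =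
  \int[L]_u (g (u ^+ 2)%R * (normal_pdf 0 1 u)%:E).
Proof.
move=> mg g0.
pose c : R := ((2 `^ 2^-1 * Gamma (2^-1 : R))^-1)%R.
pose k (z : R) := g z * (c * expR (- z / 2))%:E.
have c0 : (0 <= c)%R.
  by rewrite invr_ge0 mulr_ge0 ?powR_ge0// Gamma_half sqrtr_ge0.
transitivity (\int[L]_z (if (0 < z)%R then k z * (z `^ (2^-1 - 1))%:E else 0)).
  apply: eq_integral => z _; rewrite /chi2_pdf; case: ifPn => _; last by rewrite mule0.
  rewrite /k -muleA -EFinM; congr (_ * _%:E).
  rewrite mul1r; change ((z `^ (2^-1 - 1) * expR (- z / 2) * c)%R = (c * expR (- z / 2) * z `^ (2^-1 - 1))%R); ring.
rewrite ge0_integral_sqr; last 2 first.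
- apply: emeasurable_funM => //; apply: measurableT_comp => //.
  apply: measurable_funM => //; apply: measurableT_comp => //.
  exact: measurable_funM.
- by move=> x; rewrite mule_ge0// lee_fin mulr_ge0// expR_ge0.
apply: eq_integral => u _; rewrite /k normal_pdfE ?oner_neq0//.
congr (_ * _%:E); rewrite /normal_peak /normal_fun subr0 expr1n mul1r.
congr (_ * _)%R; rewrite /c Gamma_half powR12_sqrt// -sqrtrM//.
by rewrite mulr_natl.
Qed.
End signed_square.

Section measurability.
Context (R : realType).

(** The inverse is discontinuous at 0, so it is rewritten with a real power of the square, a
    measurable function. At 0 the outer factor [x] gives 0, the value of [0^-1]. *)
Lemma measurable_invr : measurable_fun [set: R] (@GRing.inv R).
Proof.
have -> : @GRing.inv R = (fun x : R => x * (x ^+ 2) `^ (-1)).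
  apply/funext => x; rewrite powR_inv1 ?sqr_ge0//.
  have [->|x0] := eqVneq x 0; first by rewrite invr0 mul0r.
  by rewrite expr2 invfM mulrA divff// mul1r.
apply: measurable_funM => //.
apply: (measurableT_comp (measurable_powR (-1))).
exact: measurable_funX.
Qed.

Lemma measurable_sqrtr : measurable_fun [set: R] (@Num.sqrt R).
Proof. exact: continuous_measurable_fun (@sqrt_continuous R). Qed.

End measurability.

#[global] Hint Extern 0 (measurable_fun _ GRing.inv) =>
  solve [exact: measurable_invr] : core.
#[global] Hint Extern 0 (measurable_fun _ Num.sqrt) =>
  solve [exact: measurable_sqrtr] : core.
#[global] Hint Extern 0 (measurable_fun _ (chi2_pdf _)) =>
  solve [exact: measurable_chi2_pdf] : core.

Ltac meas :=
  match goal with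
  | |- _ => done
  | |- measurable_fun _ (fun x => (_ * _)%E) => apply: emeasurable_funM; meas
  | |- measurable_fun _ (fun x => (_ + _)%E) => apply: emeasurable_funD; meas
  | |- measurable_fun _ (fun x => (_ * _)%R) => apply: measurable_funM; meas
  | |- measurable_fun _ (fun x => (_ + _)%R) => apply: measurable_funD; meas
  | |- measurable_fun _ (fun x => (_ ^+ _)%R) => apply: measurable_funX; meas
  | |- measurable_fun _ (fun x => (_ < _)%R) => apply: measurable_fun_ltr; meas
  | |- measurable_fun _ (fun x => (_ <= _)%R) => apply: measurable_fun_ler; meas
  | |- measurable_fun _ (Order.lt _) => apply: measurable_fun_ltr; meas
  | |- measurable_fun _ (Order.le _) => apply: measurable_fun_ler; meas
  | |- measurable_fun _ (GRing.add _) => apply: measurable_funD; meas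
  | |- measurable_fun _ (fun x => if _ then _ else _) =>
      apply: measurable_fun_ifT; meas
  | |- measurable_fun _ (fun x => (_, _)) => apply: measurable_fun_pair; meas
  | |- measurable_fun _ (fun x => powR _ _) =>
      apply: (measurableT_comp (measurable_powR _)); meas
  | H : measurable_fun _ ?f |- measurable_fun _ (fun x => ?f _) =>
      apply: (measurableT_comp H); meas
  | |- measurable_fun _ (fun x => ?h _) =>
      apply: (@measurableT_comp _ _ _ _ _ _ h); meas
  end.

(** * Student's distribution *)

Section student_change.
Context (R : realType) (m : R).
Local Notation L := (@lebesgue_R R).
Local Open Scope ereal_scope.

Definition student_kernel (b : R) : R := ((1 + b ^+ 2) `^ (- ((m + 1) / 2)))%R.

(** Proportional to the [chi2] density with [m + 1] degrees of freedom, the central law of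
    [s = w + u ^+ 2]. Its constant is that of [chi2_pdf m], so that the change of variables produces
    no further factor. *)
Definition scale_kernel (s : R) : R :=
  (if 0 < s then s `^ ((m - 1) / 2) * expR (- s / 2) / (2 `^ (m / 2) * Gamma (m / 2))
  else 0)%R.

Lemma Gamma_ge0 (a : R) : (0 <= Gamma a)%R.
Proof.
by apply: Rintegral_ge0 => y _; rewrite mulr_ge0 ?powR_ge0 ?expR_ge0.
Qed.

Lemma scale_kernel_ge0 s : (0 <= scale_kernel s)%R.
Proof.
rewrite /scale_kernel; case: ifP => // _.
by rewrite !mulr_ge0 ?powR_ge0 ?expR_ge0// invr_ge0 mulr_ge0 ?powR_ge0 ?Gamma_ge0.
Qed.

Lemma measurable_scale_kernel : measurable_fun [set: R] scale_kernel.
Proof. unfold scale_kernel; meas. Qed.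

Lemma measurable_student_kernel : measurable_fun [set: R] student_kernel.
Proof. unfold student_kernel; meas. Qed.

Lemma onesqr_gt0 (b : R) : (0 < 1 + b ^+ 2)%R.
Proof. by rewrite ltr_pwDl// sqr_ge0. Qed.

Lemma student_kernel_gt0 b : (0 < student_kernel b)%R.
Proof. by rewrite powR_gt0// onesqr_gt0. Qed.

#[local] Hint Extern 0 (measurable_fun _ scale_kernel) =>
  solve [exact: measurable_scale_kernel] : core.
#[local] Hint Extern 0 (measurable_fun _ student_kernel) =>
  solve [exact: measurable_student_kernel] : core.

Variable G : R * R -> \bar R.
Hypothesis mG : measurable_fun [set: R * R] G.
Hypothesis G0 : forall z, 0 <= G z.

(** The factors [(1 + b ^+ 2)^-1] and [Num.sqrt w] are the Jacobians of the two substitutions. Since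
    [u ^+ 2 + w = s], the exponentials depend on [s] alone, and the density splits into a factor in
    [b] and one in [s]. *)
Lemma student_change_pointwise (b s : R) : (0 < s)%R ->
  let w := (s / (1 + b ^+ 2))%R in
  ((1 + b ^+ 2)^-1 * (Num.sqrt w * expR (- (b * Num.sqrt w) ^+ 2 / 2) * chi2_pdf m w) =
   student_kernel b * scale_kernel s)%R.
Proof.
move=> s0 w.
have b0 := onesqr_gt0 b.
have w0 : (0 < w)%R by rewrite divr_gt0.
rewrite /chi2_pdf w0 /scale_kernel s0 /student_kernel.
set C := (2 `^ _ * _)%R.
rewrite exprMn sqr_sqrtr 1?ltW//.
rewrite -(powR12_sqrt (ltW w0)).
transitivity ((1 + b ^+ 2)^-1 * (w `^ 2^-1 * w `^ (m / 2 - 1)) *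
   (expR (- (b ^+ 2 * w) / 2) * expR (- w / 2)) / C)%R; first by ring.
rewrite -powRD; last by rewrite (gt_eqF w0) implybT.
rewrite -expRD.
have -> : (- (b ^+ 2 * w) / 2 + - w / 2 = - s / 2)%R.
  have sE : s = (w * (1 + b ^+ 2))%R by rewrite divfK// gt_eqF.
  by rewrite [in RHS]sE; ring.
have -> : (2^-1 + (m / 2 - 1) = (m - 1) / 2)%R by lra.
rewrite /w powRM ?(ltW s0) ?invr_ge0 ?(ltW b0)//.
rewrite -powR_inv1 ?(ltW b0)// -powRrM.
have -> : ((1 + b ^+ 2) `^ (- ((m + 1) / 2)))%R =
   ((1 + b ^+ 2) `^ (-1) * (1 + b ^+ 2) `^ (-1 * ((m - 1) / 2)))%R.
  by rewrite -powRD ?(gt_eqF b0) ?implybT//; congr powR; lra.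
by ring.
Qed.

(* The substitution [u = b * sqrt w], [s = w * (1 + b ^+ 2)]. *)
Lemma ge0_integral_student :
  \int[L]_w \int[L]_u (G (u, w) * (expR (- u ^+ 2 / 2) * chi2_pdf m w)%:E) =
  \int[L]_s \int[L]_b (G (b * Num.sqrt (s / (1 + b ^+ 2)), s / (1 + b ^+ 2))%R *
    (student_kernel b * scale_kernel s)%:E).
Proof.
have c0 w : (0 <= chi2_pdf m w)%R by exact: chi2_pdf_ge0.
pose K (z : R * R) := G (z.1 * Num.sqrt z.2, z.2)%R *
  (Num.sqrt z.2 * expR (- (z.1 * Num.sqrt z.2) ^+ 2 / 2) * chi2_pdf m z.2)%:E.
have mK : measurable_fun [set: R * R] K by rewrite /K; meas.
have K0 z : 0 <= K z by rewrite mule_ge0// lee_fin !mulr_ge0 ?expR_ge0.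
transitivity (\int[L]_w \int[L]_b K (b, w)).
  apply: eq_integral => w _.
  have [w0|w0] := ltP 0%R w; last first.
    by rewrite !integral0_eq// => b _; rewrite /K /chi2_pdf /= ltNge w0/= !mulr0 mule0.
  have sw0 : (0 < Num.sqrt w)%R by rewrite sqrtr_gt0.
  rewrite (ge0_integral_affine 0 sw0); last 2 first.
  - meas.
  - by move=> x; rewrite mule_ge0// lee_fin mulr_ge0 ?expR_ge0.
  rewrite -ge0_integralZl ?lee_fin ?ltW//; last 2 first.
  - meas.
  - by move=> x _; rewrite mule_ge0// lee_fin mulr_ge0 ?expR_ge0.
  apply: eq_integral => b _; rewrite /K/= addr0 (mulrC b) muleCA -EFinM mulrA.
  by [].
(* With [w] innermost and [b] fixed, [w = s / (1 + b ^+ 2)] is a linear substitution. *)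
transitivity (\int[L]_b \int[L]_w K (b, w)).
  exact/esym/(@fubini_tonelli _ _ _ _ _ L L K).
pose K' (z : R * R) := G (z.1 * Num.sqrt (z.2 / (1 + z.1 ^+ 2)), z.2 / (1 + z.1 ^+ 2))%R *
    (student_kernel z.1 * scale_kernel z.2)%:E.
have mK' : measurable_fun [set: R * R] K' by rewrite /K'; meas.
have K'0 z : 0 <= K' z.
  by rewrite mule_ge0// lee_fin mulr_ge0 ?scale_kernel_ge0// ltW ?student_kernel_gt0.
transitivity (\int[L]_b \int[L]_s K' (b, s)); last first.
  exact: (@fubini_tonelli _ _ _ _ _ L L K').
apply: eq_integral => b _.
have b0 := onesqr_gt0 b.
have ib0 : (0 < (1 + b ^+ 2)^-1)%R by rewrite invr_gt0.
rewrite (ge0_integral_affine 0 ib0)//; last first.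
  by apply: measurableT_comp => //; exact: measurable_fun_pair2.
rewrite -ge0_integralZl ?lee_fin ?ltW//; last first.
  by apply: (measurableT_comp mK); meas.
apply: eq_integral => s _; rewrite addr0 [((1 + b ^+ 2)^-1 * s)%R]mulrC.
have [s0|s0] := ltP 0%R s; last first.
  rewrite /K /K' /= /scale_kernel ltNge s0 /= mulr0 mule0.
  by rewrite /chi2_pdf ltNge pmulr_lle0 ?invr_gt0// s0 !mulr0 !mule0.
by rewrite /K /K' /= muleCA -EFinM student_change_pointwise.
Qed.

End student_change.

#[global] Hint Extern 0 (measurable_fun _ (scale_kernel _)) =>
  solve [exact: measurable_scale_kernel] : core.
#[global] Hint Extern 0 (measurable_fun _ (student_kernel _)) =>
  solve [exact: measurable_student_kernel] : core.

(** * An inequality for comonotone functions *)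

Section comonotone.
Context d (T : measurableType d) (R : realType).
Variables (nu : {measure set T -> \bar R}) (p H : T -> R) (r : T -> nat) (a : R).
Hypotheses (mp : measurable_fun [set: T] p) (mH : measurable_fun [set: T] H).
Hypotheses (H0 : forall x, 0 <= H x) (r0 : forall x, (0 < r x)%N) (a0 : 0 < a).
Hypothesis pH : forall x y, p x <= p y -> H y <= H x.
Hypothesis pr : forall x y, p x <= p y -> (r y <= r x)%N.
(** Equality at [a] provides the reference mass. At the larger thresholds only an upper bound is
    available, because [k * a] may exceed the total mass. *)
Hypothesis nu1 : nu [set x | p x <= a] = a%:E.
Hypothesis nuk : forall k : nat, (nu [set x | (p x <= k%:R * a)%R] <= (k%:R * a)%:E)%E.
Local Open Scope ereal_scope.

Let S k := [set x | (p x <= k%:R * a)%R].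
Let mS k : measurable (S k).
Proof.
have -> : S k = [set: T] `&` [set x | (p x <= k%:R * a)%R] by rewrite setTI.
exact: measurable_fun_le.
Qed.

(* [H] is at most its infimum over [S 1] outside [S 1], and [nu (S k `\` S 1) <= (k - 1) * a]. *)
Lemma integral_sublevel_le (k : nat) : (0 < k)%N ->
  \int[nu]_(x in S k) (H x)%:E <= k%:R%:E * \int[nu]_(x in S 1%N) (H x)%:E.
Proof.
move=> k0.
have mHE D : measurable_fun D (fun x => (H x)%:E).
  by apply/measurable_EFinP; exact: measurable_funTS.
have S1k : S 1%N `<=` S k.
  by move=> x /= /le_trans; apply; rewrite ler_pM2r// ler_nat.
have nuS1 : nu (S 1%N) = a%:E by rewrite /S; under eq_set do rewrite mul1r.
have -> : S k = S 1%N `|` (S k `\` S 1%N) by rewrite setDUK.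
rewrite ge0_integral_setU//; last 3 first.
- exact: measurableD.
- by move=> x _; rewrite lee_fin.
- by apply/disj_setPS => x [? []].
pose h := inf [set H x | x in S 1%N].
have S1n0 : [set H x | x in S 1%N] !=set0.
  apply/set0P/eqP => /image_set0_set0 S10; move: nuS1; rewrite S10 measure0.
  by move=> /esym/eqP; rewrite eqe gt_eqF.
have lbS1 : has_lbound [set H x | x in S 1%N] by exists 0%R => _ [x _ <-].
have leh x : S 1%N x -> (h <= H x)%R by move=> Sx; apply: ge_inf => //; exists x.
have hge x : ~ S 1%N x -> (H x <= h)%R.
  move=> nSx; apply: lb_le_inf => // _ [y Sy <-]; apply: pH.
  by apply: (le_trans Sy); rewrite ltW// ltNge; apply/negP.
have h0 : (0 <= h)%R by apply: lb_le_inf => // _ [y Sy <-].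
have I2 : \int[nu]_(x in S k `\` S 1%N) (H x)%:E <= (h * (k%:R * a - a))%:E.
  apply: (@le_trans _ _ (\int[nu]_(x in S k `\` S 1%N) h%:E)).
    apply: ge0_le_integral => //.
    - exact: measurableD.
    - by move=> x _; rewrite lee_fin.
    - by move=> x [_ /hge]; rewrite lee_fin.
  rewrite integral_cst; last exact: measurableD.
  rewrite EFinM lee_wpmul2l ?lee_fin// measureD//; last first.
    by rewrite (le_lt_trans (nuk k))// ltry.
  have -> : S k `&` S 1%N = S 1%N by exact: setIidr.
  rewrite EFinB -nuS1; apply: leeB => //; exact: nuk.
(* The part outside [S 1] contributes at most [k - 1] copies of [h * a], and each copy is bounded by
   the integral over [S 1]. *)
have I1 : (h * a)%:E <= \int[nu]_(x in S 1%N) (H x)%:E.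
  by rewrite EFinM -nuS1 -integral_cst//; apply: ge0_le_integral.
have -> : k%:R%:E = 1%:E + k.-1%:R%:E :> \bar R.
  by rewrite -EFinD -[in RHS](natrD _ 1 k.-1) add1n prednK.
rewrite ge0_muleDl ?lee_fin// mul1e leeD2l// (le_trans I2)//.
apply: (@le_trans _ _ (k.-1%:R%:E * (h * a)%:E)); last by rewrite lee_wpmul2l ?lee_fin.
rewrite -EFinM lee_fin mulrCA ler_wpM2l//.
by rewrite -{1}(prednK k0) -natr1 mulrDl mul1r addrK.
Qed.

(* With [k] the least value of [r] where [p <= r * a], comonotonicity puts the
   whole region inside [S k]. *)
Lemma integral_comonotone_le :
  \int[nu]_x ((if (p x <= (r x)%:R * a)%R then (r x)%:R^-1 * H x else 0)%R)%:E <=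
  \int[nu]_(x in [set x | (p x <= a)%R]) (H x)%:E.
Proof.
pose D := [set x | (p x <= (r x)%:R * a)%R].
have [D0|/set0P [x1 Dx1]] := eqVneq D set0.
  rewrite integral0_eq ?integral_ge0//; first by move=> x _; rewrite lee_fin.
  move=> x _; case: ifPn => // xr; have : D x by [].
  by rewrite D0.
have exk : exists k, `[< exists2 x, D x & r x = k >].
  by exists (r x1); apply/asboolP; exists x1.
case: (ex_minnP exk) => k /asboolP [x2 Dx2 rx2] kmin.
have k0 : (0 < k)%N by rewrite -rx2.
have kR0 : (0 < k%:R :> R)%R by rewrite ltr0n.
(* The point [x2] of [D] attains the minimum [k]. A point of [D] with smaller [p] lies below the
   threshold of [x2]. One with larger [p] has [r x <= k], hence [r x = k] by minimality, and faces
   the same threshold. *)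
have DS : D `<=` S k.
  move=> x Dx; have krx : (k <= r x)%N by apply: kmin; apply/asboolP; exists x.
  have [px|px] := leP (p x) (p x2).
    by apply: (le_trans px); rewrite -rx2; exact: Dx2.
  have : (r x <= k)%N by rewrite -rx2; apply: pr; exact: ltW.
  rewrite leq_eqVlt ltnNge krx orbF => /eqP rxk.
  by rewrite /S /= -rxk; exact: Dx.
apply: (@le_trans _ _ (\int[nu]_(x in S k) (k%:R^-1 * H x)%:E)).
  rewrite [leRHS]integral_mkcond; apply: ge0_le_integral_nonmeas => x.
    by case: ifP => // _; rewrite lee_fin mulr_ge0.
  rewrite patchE; case: ifPn => xr.
    have Dx : D x by [].
    rewrite mem_set; last exact: DS.
    rewrite lee_fin ler_wpM2r// lef_pV2 ?posrE ?ltr0n// ler_nat.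
    by apply: kmin; apply/asboolP; exists x.
  by case: ifP => // _; rewrite lee_fin mulr_ge0// ltW ?invr_gt0.
under eq_integral do rewrite EFinM.
rewrite ge0_integralZl//; last 2 first.
- by apply/measurable_EFinP; exact: measurable_funTS.
- by move=> x _; rewrite lee_fin.
rewrite (@le_trans _ _ (k%:R^-1%:E * (k%:R%:E * \int[nu]_(x in S 1%N) (H x)%:E)))//.
  by rewrite lee_wpmul2l ?integral_sublevel_le// lee_fin invr_ge0 ltW.
rewrite muleA -EFinM mulVf ?gt_eqF// mul1e.
by rewrite /S; under eq_set do rewrite mul1r.
Qed.

End comonotone.

Lemma chi2_distE (R : realType) (k : R) (A : set R) : measurable A ->
  chi2_dist k A = (\int[@lebesgue_R R]_(x in A) (chi2_pdf k x)%:E)%E.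
Proof.
move=> mA; rewrite /chi2_dist ge0_integral_lebesgue_R//.
- by apply/measurable_EFinP; apply: measurable_funTS; exact: measurable_chi2_pdf.
- by move=> w _; rewrite lee_fin chi2_pdf_ge0.
Qed.

Section student_law.
Context (R : realType) (m : R).
Local Notation L := (@lebesgue_R R).
(** Normalizing by the integral itself avoids the closed form with Gamma functions. That the
    integral is positive and finite, so that [fine] and the division are meaningful, is shown
    below. *)
Definition student_pdf (b : R) : R :=
  student_kernel m b / fine (\int[L]_b (student_kernel m b)%:E)%E.

Lemma measurable_student_pdf : measurable_fun [set: R] student_pdf.
Proof. by apply: measurable_funM. Qed.

Lemma student_pdf_ge0 b : 0 <= student_pdf b.
Proof.
rewrite divr_ge0 ?(ltW (student_kernel_gt0 _ _))// fine_ge0//.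
by apply: integral_ge0 => x _; rewrite lee_fin ltW ?student_kernel_gt0.
Qed.

(* The law of [t / sqrt m]. *)
Definition student_dist : {measure set R -> \bar R} :=
  density_measure L measurable_student_pdf student_pdf_ge0.

Lemma student_distE (A : set R) :
  student_dist A = (\int[L]_(x in A) (student_pdf x)%:E)%E.
Proof. by []. Qed.

Lemma ge0_integral_student_dist (g : R -> \bar R) :
  measurable_fun [set: R] g -> (forall x, 0 <= g x)%E ->
  (\int[student_dist]_x g x = \int[L]_x (g x * (student_pdf x)%:E))%E.
Proof. exact: ge0_integral_density_measure. Qed.

Opaque student_dist.

(* Holds for [0 < m]; assumed because the law of [V] being a probability gives it
   for free. *)
Hypothesis chi2T : chi2_dist m [set: R] = 1%E.
Local Open Scope ereal_scope.

Lemma integral_gauss_half : \int[L]_u (expR (- u ^+ 2 / 2))%:E = (normal_peak (1 : R))^-1%:E.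
Proof.
have p0 : (0 < normal_peak (1 : R))%R by rewrite normal_peak_gt0// oner_neq0.
have := @integral_normal_pdf R 0 1.
rewrite ge0_integral_lebesgue_R//; last 2 first.
- by apply/measurable_EFinP; exact: measurable_normal_pdf.
- by move=> x _; rewrite lee_fin normal_pdf_ge0.
under eq_integral.
  move=> u _; rewrite normal_pdfE ?oner_neq0// EFinM /normal_fun subr0 expr1n.
  over.
rewrite ge0_integralZl//; last 2 first.
- meas.
- by rewrite lee_fin ltW.
move=> /(congr1 (fun x => (normal_peak (1 : R))^-1%:E * x)).
by rewrite muleA -EFinM mulVf ?gt_eqF// mul1e mule1.
Qed.

Lemma integral_chi2_pdf : \int[L]_w (chi2_pdf m w)%:E = 1.
Proof.
by rewrite -chi2T chi2_distE.
Qed.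

(** The product form expresses the independence of [u / sqrt w] and [u ^+ 2 + w] under the central
    law. *)
Lemma ge0_integral_ratio (g : R -> \bar R) :
  measurable_fun [set: R] g -> (forall x, 0 <= g x) ->
  \int[L]_w \int[L]_u (g (u / Num.sqrt w)%R * (expR (- u ^+ 2 / 2) * chi2_pdf m w)%:E) =
  (\int[L]_b (g b * (student_kernel m b)%:E)) * \int[L]_s (scale_kernel m s)%:E.
Proof.
move=> mg g0.
rewrite (ge0_integral_student m (G := fun z => g (z.1 / Num.sqrt z.2)%R)); last 2 first.
- meas.
- by [].
have k0 b : 0 <= (student_kernel m b)%:E by rewrite lee_fin ltW ?student_kernel_gt0.
have s0 s : 0 <= (scale_kernel m s)%:E by rewrite lee_fin scale_kernel_ge0.
rewrite -ge0_integralZl//; last 2 first.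
- by apply/measurable_EFinP; exact: measurable_scale_kernel.
- by apply: integral_ge0 => b _; rewrite mule_ge0.
apply: eq_integral => s _.
rewrite -ge0_integralZr//; last 2 first.
- meas.
- by move=> b _; rewrite mule_ge0.
apply: eq_integral => b _ /=.
have [sgt0|sle0] := ltP 0%R s; last first.
  by rewrite /scale_kernel ltNge sle0/= mulr0 !mule0.
rewrite EFinM muleA mulfK// gt_eqF// sqrtr_gt0 divr_gt0//.
exact: onesqr_gt0.
Qed.

(** The case [g = 1] of the factorization. Since the product is positive and finite, neither factor
    can be zero or infinite, which replaces a computation of Beta and Gamma integrals. *)
Lemma integral_student_scale :
  (\int[L]_b (student_kernel m b)%:E) * \int[L]_s (scale_kernel m s)%:E =
  (normal_peak (1 : R))^-1%:E.
Proof.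
have := ge0_integral_ratio (measurable_cst 1) (fun=> lee01).
rewrite (eq_integral (fun w => (normal_peak (1 : R))^-1%:E * (chi2_pdf m w)%:E)); last first.
  move=> w _; rewrite -integral_gauss_half -ge0_integralZr//.
  - by apply: eq_integral => u _; rewrite mul1e EFinM.
  - meas.
  - by rewrite lee_fin chi2_pdf_ge0.
rewrite ge0_integralZl//; last 3 first.
- meas.
- by move=> x _; rewrite lee_fin chi2_pdf_ge0.
- by rewrite lee_fin invr_ge0 normal_peak_ge0.
rewrite integral_chi2_pdf mule1 => ->; congr (_ * _).
by apply: eq_integral => b _; rewrite mul1e.
Qed.

Lemma integral_student_kernel_gt0 : 0 < \int[L]_b (student_kernel m b)%:E.
Proof.
rewrite lt0e integral_ge0 ?andbT; last first.
  by move=> b _; rewrite lee_fin ltW ?student_kernel_gt0.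
apply/eqP => k0; have := integral_student_scale; rewrite k0 mul0e => /eqP.
by rewrite eqe lt_eqF// invr_gt0 normal_peak_gt0 ?oner_neq0.
Qed.

Lemma integral_student_kernel_fin : \int[L]_b (student_kernel m b)%:E \is a fin_num.
Proof.
rewrite ge0_fin_numE; last by rewrite ltW ?integral_student_kernel_gt0.
rewrite ltey; apply/eqP => ky; have := integral_student_scale; rewrite ky.
have [s0|s0|] := ltgtP (\int[L]_s (scale_kernel m s)%:E) 0.
- have : 0 <= \int[L]_s (scale_kernel m s)%:E.
    by apply: integral_ge0 => s _; rewrite lee_fin scale_kernel_ge0.
  by rewrite leNgt s0.
- by rewrite gt0_mulye.
- move=> ->; rewrite mule0 => /eqP.
  by rewrite eqe lt_eqF// invr_gt0 normal_peak_gt0 ?oner_neq0.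
Qed.

Lemma student_mass_gt0 : (0 < fine (\int[L]_b (student_kernel m b)%:E))%R.
Proof.
rewrite fine_gt0// integral_student_kernel_gt0/= ltey_eq.
by rewrite integral_student_kernel_fin.
Qed.

Lemma student_pdf_gt0 b : (0 < student_pdf b)%R.
Proof. by rewrite divr_gt0 ?student_kernel_gt0 ?student_mass_gt0. Qed.

Lemma student_kernelE b :
  (student_kernel m b)%:E = (student_pdf b)%:E * \int[L]_b (student_kernel m b)%:E.
Proof.
rewrite -(fineK integral_student_kernel_fin) -EFinM divfK// gt_eqF//.
exact: student_mass_gt0.
Qed.

Lemma ge0_integral_tstat (g : R -> \bar R) :
  measurable_fun [set: R] g -> (forall x, 0 <= g x) ->
  \int[L]_w \int[L]_u (g (u / Num.sqrt w)%R * (normal_pdf 0 1 u * chi2_pdf m w)%:E) =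
  \int[student_dist]_b g b.
Proof.
move=> mg g0.
have p0 : (0 < normal_peak (1 : R))%R by rewrite normal_peak_gt0// oner_neq0.
rewrite ge0_integral_student_dist//.
have kE : \int[L]_b (g b * (student_kernel m b)%:E) =
    \int[L]_b (g b * (student_pdf b)%:E) * \int[L]_b (student_kernel m b)%:E.
  rewrite -ge0_integralZr//; last 3 first.
  - by have mpdf := measurable_student_pdf; meas.
  - by move=> b _; rewrite mule_ge0// lee_fin student_pdf_ge0.
  - exact/ltW/integral_student_kernel_gt0.
  by apply: eq_integral => b _; rewrite student_kernelE muleA.
have -> : \int[L]_b (g b * (student_pdf b)%:E) =
    (normal_peak (1 : R))%:E * ((\int[L]_b (g b * (student_kernel m b)%:E)) *
    \int[L]_s (scale_kernel m s)%:E).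
  rewrite kE -muleA integral_student_scale muleCA -EFinM mulfV ?gt_eqF// mule1//.
pose F (z : R * R) :=
  g (z.1 / Num.sqrt z.2)%R * (expR (- z.1 ^+ 2 / 2) * chi2_pdf m z.2)%:E.
have mF : measurable_fun [set: R * R] F by unfold F; meas.
have F0 z : 0 <= F z by rewrite mule_ge0// lee_fin mulr_ge0 ?expR_ge0 ?chi2_pdf_ge0.
rewrite -ge0_integral_ratio// -ge0_integralZl//; last 3 first.
- exact: (measurable_fun_fubini_tonelli_G F).
- by move=> w _; apply: integral_ge0 => u _; exact: (F0 (u, w)).
- by rewrite lee_fin ltW.
apply: eq_integral => w _; rewrite -ge0_integralZl//; last 3 first.
- by meas.
- by move=> u _; exact: (F0 (u, w)).
- by rewrite lee_fin ltW.
apply: eq_integral => u _.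
rewrite normal_pdfE ?oner_neq0// /normal_fun subr0 expr1n muleCA -EFinM.
by rewrite mulrA.
Qed.

Lemma student_distT : student_dist [set: R] = 1.
Proof.
rewrite -[LHS]mul1e -integral_cst// -(ge0_integral_tstat (measurable_cst 1) (fun=> lee01)).
rewrite -[RHS]integral_chi2_pdf; apply: eq_integral => w _.
rewrite (eq_integral (fun u => (normal_pdf 0 1 u)%:E * (chi2_pdf m w)%:E)); last first.
  by move=> u _; rewrite mul1e EFinM.
rewrite ge0_integralZr//; last 3 first.
- by apply/measurable_EFinP; exact: measurable_normal_pdf.
- by move=> x _; rewrite lee_fin normal_pdf_ge0.
- by rewrite lee_fin chi2_pdf_ge0.
rewrite -ge0_integral_lebesgue_R//; last 2 first.
- by apply/measurable_EFinP; exact: measurable_normal_pdf.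
- by move=> x _; rewrite lee_fin normal_pdf_ge0.
by rewrite integral_normal_pdf mul1e.
Qed.

(** Writing the [chi2_1] numerator as the square of a standard normal [u] turns the F ratio into
    [m * b ^+ 2] with [b = u / sqrt w]. *)
Lemma F_distE (x : R) : (0 < m)%R ->
  F_dist 1 m `]-oo, x] = student_dist [set b | (m * b ^+ 2 <= x)%R].
Proof.
move=> m0.
pose A := [set z : R * R | ((z.1 / 1) / (z.2 / m) <= x)%R].
have mA : measurable A.
  rewrite -[A]setTI; apply: measurable_fun_le => //; meas.
have mS : measurable [set b : R | (m * b ^+ 2 <= x)%R].
  rewrite -[X in measurable X]setTI; apply: measurable_fun_le => //; meas.
have -> : F_dist 1 m `]-oo, x] = (chi2_dist 1 \x chi2_dist m) A.
  by rewrite /F_dist /pushforward; congr (_ _); apply/seteqP; split => z /=;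
    rewrite in_itv.
rewrite /product_measure1.
have -> : chi2_dist m \o xsection A = fun z => \int[L]_w ((\1_A (z, w))%:E * (chi2_pdf m w)%:E).
  apply/funext => z /=; rewrite chi2_distE; last exact: measurable_xsection.
  rewrite integral_mkcond; apply: eq_integral => w _.
  rewrite patchE indicE mem_xsection; case: ifP; rewrite ?mul1e ?mul0e//.
pose F (z : R * R) := (\1_A z)%:E * (chi2_pdf m z.2)%:E.
have mF : measurable_fun [set: R * R] F by unfold F; meas.
have F0 z : 0 <= F z by rewrite mule_ge0// lee_fin ?chi2_pdf_ge0.
have mFu : measurable_fun [set: R] (fun z => \int[L]_w F (z, w)).
  exact: (measurable_fun_fubini_tonelli_F F).
rewrite (@ge0_integral_density _ _ _ (chi2_dist 1) L (chi2_pdf 1))//; last 3 first.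
- exact: chi2_pdf_ge0.
- exact: chi2_distE.
- by move=> z; apply: integral_ge0 => w _; exact: (F0 (z, w)).
rewrite (ge0_integral_chi2_1 mFu); last first.
  by move=> z; apply: integral_ge0 => w _; exact: (F0 (z, w)).
have mnpdf := @measurable_normal_pdf R 0 1.
pose F' (z : R * R) := F (z.1 ^+ 2, z.2)%R * (normal_pdf 0 1 z.1)%:E.
have mF' : measurable_fun [set: R * R] F' by unfold F'; meas.
have F'0 z : 0 <= F' z by rewrite mule_ge0// lee_fin normal_pdf_ge0.
transitivity (\int[L]_u \int[L]_w F' (u, w)).
  apply: eq_integral => u _; rewrite -ge0_integralZr//; last 2 first.
  - meas.
  - by rewrite lee_fin normal_pdf_ge0.
rewrite (@fubini_tonelli _ _ _ _ _ L L F')//.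
transitivity (\int[student_dist]_b (\1_[set b | (m * b ^+ 2 <= x)%R] b)%:E); last first.
  by rewrite integral_indic// setIT.
have mi : measurable_fun [set: R] (fun b => (\1_[set b | (m * b ^+ 2 <= x)%R] b)%:E : \bar R).
  by apply/measurable_EFinP; exact: measurable_indic.
rewrite -(ge0_integral_tstat mi); last by move=> b; rewrite lee_fin.
apply: eq_integral => w _; apply: eq_integral => u _.
have [w0|w0] := ltP 0%R w; last first.
  by rewrite /F' /F /= /chi2_pdf ltNge w0/= !mulr0 !mule0 mul0e.
have -> : \1_[set b | (m * b ^+ 2 <= x)%R] (u / Num.sqrt w)%R =
    \1_A (u ^+ 2, w)%R :> R.
  have uE : (u ^+ 2 / 1 / (w / m) = m * (u / Num.sqrt w) ^+ 2)%R.
    rewrite expr_div_n sqr_sqrtr 1?ltW//; field.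
    by rewrite !gt_eqF.
  by rewrite !indicE; congr (nat_of_bool _)%:R; apply/idP/idP;
    move=> /set_mem/= h; apply/mem_set; move: h; rewrite /A /= uE.
by rewrite /F' /F /= -muleA -EFinM (mulrC (chi2_pdf m w)).
Qed.

End student_law.

(** The default value matters twice: the p-value 1 of a zero statistic has no preimage in []0,
    +oo[], and the constant [a] must be shown to have one. *)
Lemma pinv_out (T U : Type) (dflt : U -> T) (A : set T) (f : T -> U) (y : U) :
  ~ (f @` A) y -> 'pinv_dflt A f y = dflt y.
Proof.
move=> yfA; rewrite /pinv_ splitV.
rewrite (_ : 'oinv_[fun f in A] y = None)//.
transitivity (if pselect ((f @` A) y) is left fAy
  then some (projT1 (cid2 fAy)) else None); first by [].
by case: pselect.
Qed.

Lemma ler_sqr_norm (R : realDomainType) (b c : R) :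
  (b ^+ 2 <= c ^+ 2) = (`|b| <= `|c|).
Proof.
by rewrite -[RHS](@ler_pXn2r _ 2) ?nnegrE// !real_normK ?num_real.
Qed.

(** * The p-value as a function of the squared statistic *)

Section psibar.
Context (R : realType) (m : R).
Local Notation L := (@lebesgue_R R).
Hypothesis chi2T : chi2_dist m [set: R] = 1%E.
Hypothesis m0 : 0 < m.
Local Notation nu := (student_dist m).
Local Notation PB := (Psibar 1 m).
Local Open Scope ereal_scope.

Lemma le_student_dist (A B : set R) : measurable A -> measurable B ->
  A `<=` B -> nu A <= nu B.
Proof. by move=> mA mB AB; apply: le_measure => //; exact: mem_set. Qed.

Lemma measurable_sqr_le (x : R) : measurable [set b : R | (x <= m * b ^+ 2)%R].
Proof.
by rewrite -[X in measurable X]setTI; apply: measurable_fun_le => //; meas.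
Qed.

Lemma measurable_sqr_ge (x : R) : measurable [set b : R | (m * b ^+ 2 <= x)%R].
Proof.
by rewrite -[X in measurable X]setTI; apply: measurable_fun_le => //; meas.
Qed.

Lemma student_dist_set1 (c : R) : nu [set c] = 0.
Proof.
rewrite student_distE.
rewrite -ge0_integral_lebesgue_R ?integral_set1//.
- by apply/measurable_EFinP; apply: measurable_funTS; exact: measurable_student_pdf.
- by move=> x _; rewrite lee_fin student_pdf_ge0.
Qed.

Lemma student_dist_sqr_eq (x : R) : nu [set b : R | m * b ^+ 2 = x]%R = 0.
Proof.
have mE : measurable [set b : R | m * b ^+ 2 = x]%R.
  rewrite (_ : mkset _ = [set b : R | (x <= m * b ^+ 2)%R] `&` [set b : R | (m * b ^+ 2 <= x)%R]).
    by apply: measurableI; [exact: measurable_sqr_le|exact: measurable_sqr_ge].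
  apply/seteqP; split => b /= ; first by move=> ->.
  by move=> [xb bx]; apply/eqP; rewrite eq_le bx.
apply/eqP; rewrite -measure_le0.
have : [set b : R | m * b ^+ 2 = x]%R `<=` [set Num.sqrt (x / m)] `|` [set - Num.sqrt (x / m)]%R.
  move=> b /= <-; rewrite mulrAC mulfV ?gt_eqF// mul1r sqrtr_sqr.
  by have [b0|b0] := leP 0%R b; [left; rewrite ger0_norm|right; rewrite ltr0_norm ?opprK].
move=> /(le_measure nu _ _) => /(_ _ _)/le_trans; apply; rewrite ?inE//.
  by apply: measurableU; exact: measurable_set1.
apply: le_trans (measureU2 nu _ _) _; try exact: measurable_set1.
by rewrite -[leRHS]adde0; apply: leeD; rewrite le_eqVlt; apply/orP; left;
  apply/eqP; exact: student_dist_set1.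
Qed.

(** One minus the cdf is the mass of the strict tail. The weak tail has the same mass, because the
    boundary consists of at most two points and the law has no atoms. *)
Lemma PsibarE (x : R) : (PB x)%:E = nu [set b | (x <= m * b ^+ 2)%R].
Proof.
rewrite /Psibar /Psi F_distE//.
have nufin A : measurable A -> nu A \is a fin_num.
  move=> mA; rewrite ge0_fin_numE// (le_lt_trans _ (ltry 1))//.
  by rewrite -(student_distT chi2T) le_measure ?inE.
rewrite EFinB fineK; last by apply: nufin; exact: measurable_sqr_ge.
pose B := [set b | (m * b ^+ 2 <= x)%R]; pose E := [set b : R | m * b ^+ 2 = x]%R.
have mB : measurable B by exact: measurable_sqr_ge.
have mBC : measurable (~` B) by exact: measurableC.
have -> : [set b | (x <= m * b ^+ 2)%R] = ~` B `|` E.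
  apply/seteqP; split => b /=.
    by rewrite le_eqVlt => /predU1P[xb|xb]; [right|left; apply/negP; rewrite -ltNge].
  by case=> [/negP|]; [rewrite -ltNge => /ltW|rewrite /E /= => ->].
have mE : measurable E.
  rewrite (_ : E = [set b : R | (x <= m * b ^+ 2)%R] `&` B).
    by apply: measurableI; [exact: measurable_sqr_le|exact: measurable_sqr_ge].
  apply/seteqP; split => b; rewrite /E /B /=; first by move=> ->.
  by move=> [xb bx]; apply/eqP; rewrite eq_le bx.
rewrite measureU//; last first.
  by apply/seteqP; split => b //; rewrite /B /E /= => -[nB bx]; case: nB; rewrite bx.
have -> : (nu (~` B) + nu E)%R = nu (~` B).
  by rewrite -[RHS]adde0; congr (_ + _)%R; exact: student_dist_sqr_eq.
rewrite -(student_distT chi2T).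
rewrite -(setvU B) measureU//.
  by rewrite addeK//; exact: nufin.
by rewrite setICl.
Qed.

Lemma le_student_kernel (b c : R) : (`|b| <= `|c|)%R ->
  (student_kernel m c <= student_kernel m b)%R.
Proof.
move=> bc; rewrite /student_kernel !powRN lef_pV2 ?posrE ?powR_gt0 ?onesqr_gt0//.
apply: ge0_ler_powR; rewrite ?nnegrE ?(ltW (onesqr_gt0 _))//.
  by rewrite divr_ge0// addr_ge0// ltW.
by rewrite lerD2l -(real_normK (num_real b)) -(real_normK (num_real c)) lerXn2r ?nnegrE.
Qed.

(** On the interval the density is at least its positive value at [c]. This makes the p-value
    strictly decreasing, hence invertible. *)
Lemma student_dist_itv_gt0 (b c : R) : (0 <= b < c)%R -> 0 < nu `[b, c[%classic.
Proof.
move=> /andP[b0 bc].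
rewrite student_distE.
apply: (@lt_le_trans _ _ (\int[L]_(x in `[b, c[) (student_pdf m c)%:E)).
  rewrite integral_cst// mule_gt0//; first by rewrite lte_fin student_pdf_gt0.
  rewrite [ltRHS](_ : _ = lebesgue_measure (`[b, c[%classic : set R))// lebesgue_measure_itv/= lte_fin bc.
  by rewrite -EFinB lte_fin subr_gt0.
apply: ge0_le_integral => //.
- by move=> x _; rewrite lee_fin student_pdf_ge0.
- by apply/measurable_EFinP; apply: measurable_funTS; exact: measurable_student_pdf.
- move=> x /=; rewrite in_itv/= => /andP[bx xc].
  rewrite lee_fin /student_pdf ler_pM2r ?invr_gt0 ?student_mass_gt0// le_student_kernel//.
  by rewrite !ger0_norm ?(le_trans b0)// ?ltW// (le_lt_trans bx).
Qed.

End psibar.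

Section pvalue.
Context (R : realType) (m : R).
Local Notation nu := (student_dist m).
Hypothesis chi2T : chi2_dist m [set: R] = 1%E.
Hypothesis m0 : 0 < m.
(* Instantiated with [Psibar 1 m], which conversion must not unfold. *)
Variable q : R -> R.
Hypothesis qE : forall x : R, (q x)%:E = nu [set b | x <= m * b ^+ 2].
Local Notation q_inv := ('pinv_(fun=> 0) `]0, +oo[ q).
Local Open Scope ereal_scope.

Lemma le_pvalue (x y : R) : (x <= y)%R -> (q y <= q x)%R.
Proof.
move=> xy; rewrite -lee_fin [X in _ <= X](qE x) [X in X <= _](qE y); apply: le_student_dist.
- by exact: measurable_sqr_le.
- by exact: measurable_sqr_le.
- by move=> b /=; exact: le_trans.
Qed.

Lemma measurable_pvalue : measurable_fun [set: R] q.
Proof.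
rewrite (_ : q = fun x => - - q x)%R; last by apply/funext => x; rewrite opprK.
apply: measurableT_comp => //; apply: nondecreasing_measurable => // x y xy.
by rewrite lerN2; exact: le_pvalue.
Qed.

Lemma pvalue_le0 (x : R) : (x <= 0)%R -> q x = 1%R.
Proof.
move=> x0; apply: EFin_inj; rewrite qE -(student_distT chi2T); congr (_ _).
apply/seteqP; split => b //= _; apply: (le_trans x0).
by rewrite mulr_ge0 ?sqr_ge0// ltW.
Qed.

Lemma lt_pvalue (x y : R) : (0 <= x < y)%R -> (q y < q x)%R.
Proof.
move=> /andP[x0 xy]; rewrite -lte_fin [X in _ < X](qE x) [X in X < _](qE y).
(* [I] lies in the tail of [x] and outside that of [y]. Its positive mass separates the two
   p-values. *)
pose I := `[Num.sqrt (x / m), Num.sqrt (y / m)[%classic : set R.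
have y0 : (0 < y)%R := le_lt_trans x0 xy.
have Igt0 : 0 < nu I.
  apply: student_dist_itv_gt0 => //; rewrite sqrtr_ge0 ltr_sqrt ?divr_gt0//.
  by rewrite ltr_pM2r ?invr_gt0.
have nufin A : measurable A -> nu A \is a fin_num.
  move=> mA; rewrite ge0_fin_numE// (le_lt_trans _ (ltry 1))//.
  by rewrite -(student_distT chi2T) le_measure ?inE.
have mI : measurable I by exact: measurable_itv.
apply: (@lt_le_trans _ _ (nu [set b | (y <= m * b ^+ 2)%R] + nu I)).
  by rewrite lteDl//; apply: nufin; exact: measurable_sqr_le.
have sqrtE (z b : R) : (0 <= z)%R -> (0 <= b)%R -> (Num.sqrt (z / m) <= b)%R = (z <= m * b ^+ 2)%R.
  move=> z0 b0; rewrite [(m * _)%R]mulrC -ler_pdivrMr// -{2}(sqr_sqrtr (divr_ge0 z0 (ltW m0))).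
  by rewrite ler_pXn2r// nnegrE sqrtr_ge0.
rewrite -measureU//; last 2 first.
- exact: measurable_sqr_le.
- apply/seteqP; split => b //= -[yb]; rewrite /I /= in_itv/= => /andP[xb].
  have b0 : (0 <= b)%R by rewrite (le_trans _ xb)// sqrtr_ge0.
  by rewrite ltNge sqrtE ?yb// ltW.
apply: le_student_dist.
- by apply: measurableU => //; exact: measurable_sqr_le.
- by exact: measurable_sqr_le.
move=> b /= [|]; first by apply: le_trans; exact: ltW.
rewrite /I /= in_itv/= => /andP[xb _].
by rewrite -sqrtE// (le_trans _ xb)// sqrtr_ge0.
Qed.

Lemma pvalue_sqr_le (b c : R) :
  (q (m * b ^+ 2) <= q (m * c ^+ 2))%R = (`|c| <= `|b|)%R.
Proof.
have sqN (z : R) : (m * z ^+ 2 = m * `|z| ^+ 2)%R by rewrite real_normK ?num_real.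
apply/idP/idP => [|cb]; last first.
  by apply: le_pvalue; rewrite (sqN b) (sqN c) ler_pM2l// lerXn2r ?nnegrE.
apply: contraTT; rewrite -!ltNge => bc; apply: lt_pvalue.
rewrite mulr_ge0 ?sqr_ge0 ?(ltW m0)//= (sqN b) (sqN c) ltr_pM2l//.
by rewrite ltrXn2r ?nnegrE.
Qed.

Lemma pvalue_ge0 x : (0 <= q x)%R.
Proof. by rewrite -lee_fin qE measure_ge0. Qed.

Lemma pvalue_lt1 x : (0 < x)%R -> (q x < 1)%R.
Proof.
by move=> x0; rewrite -(pvalue_le0 (lexx 0%R)); apply: lt_pvalue; rewrite lexx.
Qed.

Lemma pvalueK x : (0 < x)%R -> q_inv (q x) = x.
Proof.
move=> x0; apply: pinvKV; last by rewrite inE/= in_itv/= x0.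
move=> y z; rewrite !inE/= !in_itv/= !andbT => y0 z0 yz.
apply/eqP; rewrite eq_le; apply/andP; split; rewrite leNgt; apply/negP => h.
  have := lt_pvalue (x := z) (y := y); rewrite (ltW z0) h => /(_ isT).
  by rewrite yz ltxx.
have := lt_pvalue (x := y) (y := z); rewrite (ltW y0) h => /(_ isT).
by rewrite yz ltxx.
Qed.

(** For [x <= 0] the p-value is 1, which is not attained on []0, +oo[], so the inverse returns its
    default 0. The round trip is thus the identity on nonnegative statistics, zero included. *)
Lemma pvalue_inv_pvalue x : q_inv (q x) = Num.max 0%R x.
Proof.
have [x0|x0] := leP x 0%R; last exact: pvalueK.
apply: pinv_out => -[y]; rewrite /= in_itv/= andbT => y0 yx.
by have := pvalue_lt1 y0; rewrite yx pvalue_le0// ltxx.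
Qed.

Lemma pvalue_inv_dichotomy (a : R) :
  q_inv a = 0%R \/ (0 < q_inv a)%R /\ q (q_inv a) = a.
Proof.
have [[x x0 <-]|qa] := pselect ((q @` `]0%R, +oo[%classic) a);
  last by left; exact: pinv_out.
right; move: x0; rewrite /= in_itv/= andbT => x0.
by rewrite pvalue_inv_pvalue max_r ?ltW.
Qed.

(** The level [u] need not be a value of [q]. With [B] the infimum of [|b|] over the sublevel set,
    any tail [t <= |c|] with [t > B] sits inside a tail of mass at most [u]. Continuity from below
    along [t = B + 1 / (n + 1)] and the nullity of [|b| = B] conclude. *)
Lemma student_dist_pvalue_le (u : R) : (0 <= u)%R ->
  nu [set b | (q (m * b ^+ 2) <= u)%R] <= u%:E.
Proof.
move=> u0.
have nuq (b : R) : nu [set c | (`|b| <= `|c|)%R] = (q (m * b ^+ 2))%:E.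
  by rewrite qE; congr (_ _); apply/seteqP; split => c /=; rewrite ler_pM2l// ler_sqr_norm.
pose S := [set b | (q (m * b ^+ 2) <= u)%R].
have mabs (b : R) : measurable [set c : R | (b <= `|c|)%R].
  rewrite -[X in measurable X]setTI; apply: measurable_fun_le => //.
have [S0|/set0P [b1 Sb1]] := eqVneq S set0.
  by rewrite -/S S0 measure0 lee_fin.
pose N : set R := [set `|b|%R | b in S]; pose B := inf N.
have N0 : N !=set0 by exists `|b1|%R; exists b1.
have lbN : has_lbound N by exists 0%R => _ [b _ <-].
have B0 : (0 <= B)%R by apply: lb_le_inf => // _ [b _ <-].
have tB (t : R) : (B < t)%R -> nu [set c | (t <= `|c|)%R] <= u%:E.
  move=> Bt; have [_ [b Sb <-] bt] := inf_lt N0 Bt.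
  apply: (@le_trans _ _ (nu [set c | (`|b| <= `|c|)%R])).
    by apply: le_student_dist => // c /=; exact/le_trans/ltW.
  by rewrite nuq lee_fin.
pose F n := [set c : R | (B + n.+1%:R^-1 <= `|c|)%R].
have mF n : measurable (F n) by exact: mabs.
have mUF : measurable (\bigcup_n F n) by exact: bigcup_measurable.
have ndF : nondecreasing_seq F.
  move=> i j ij; apply/subsetPset => c; apply: le_trans.
  by rewrite lerD2l lef_pV2 ?posrE// ler_nat.
have UFu : nu (\bigcup_n F n) <= u%:E.
  have cF := nondecreasing_cvg_mu (mu := nu) mF mUF ndF.
  have /cvg_lim <- // := cF.
  apply: lime_le; first exact: cvgP cF.
  by apply: nearW => n; apply: tB; rewrite ltrDl invr_gt0.
apply: (le_trans _ UFu).
pose E := [set b : R | m * b ^+ 2 = m * B ^+ 2]%R.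
have mS : measurable S.
  rewrite -[S]setTI; apply: measurable_fun_le => //.
  apply: (@measurableT_comp _ _ _ _ _ _ q); last by meas.
  exact: measurable_pvalue.
have mE : measurable E.
  rewrite (_ : E = [set b : R | (m * B ^+ 2 <= m * b ^+ 2)%R] `&` [set b : R | (m * b ^+ 2 <= m * B ^+ 2)%R]).
    by apply: measurableI; [exact: measurable_sqr_le|exact: measurable_sqr_ge].
  apply/seteqP; split => b; rewrite /E /=; first by move=> ->.
  by move=> [xb bx]; apply/eqP; rewrite eq_le bx.
have : S `<=` \bigcup_n F n `|` E.
  move=> b Sb; have : (B <= `|b|)%R by apply: ge_inf => //; exists b.
  rewrite le_eqVlt => /predU1P[Bb|Bb].
    by right; rewrite /E /= Bb real_normK ?num_real.
  left; have /ltr_add_invr [n Bn] := Bb.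
  by exists n => //; exact: ltW.
move=> SFE; have mFE : measurable (\bigcup_n F n `|` E) by exact: measurableU.
apply: le_trans (le_student_dist _ mS mFE SFE) _.
apply: le_trans (measureU2 nu mUF mE) _.
by rewrite -[leRHS]adde0 leeD2l// le_eqVlt; apply/orP; left; apply/eqP; exact: student_dist_sqr_eq.
Qed.

Lemma student_dist_pvalue_eq (a : R) : (0 < q_inv a)%R -> q (q_inv a) = a ->
  nu [set b | (q (m * b ^+ 2) <= a)%R] = a%:E.
Proof.
set c := q_inv a => c0 qc.
pose b := Num.sqrt (c / m).
have cb : c = (m * b ^+ 2)%R.
  by rewrite /b sqr_sqrtr ?divr_ge0 ?(ltW c0) ?(ltW m0)// mulrC divfK ?gt_eqF.
rewrite -[in RHS]qc qE; congr (_ _); apply/seteqP; split => e /=;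
by rewrite -qc cb pvalue_sqr_le ler_pM2l// ler_sqr_norm.
Qed.

End pvalue.

Lemma ler_cosh (R : realType) (theta s t : R) : 0 <= s <= t ->
  expR (theta * s) + expR (- (theta * s)) <= expR (theta * t) + expR (- (theta * t)).
Proof.
wlog th0 : theta / 0 <= theta.
  move=> wl; have [|th0] := leP 0 theta; first exact: wl.
  move=> st; have := wl (- theta); rewrite oppr_ge0 (ltW th0) => /(_ isT st).
  by rewrite !mulNr !opprK addrC [leRHS]addrC.
move=> /andP[s0 st].
set A := theta * s; set B := theta * t.
have A0 : 0 <= A by rewrite mulr_ge0.
have AB : A <= B by rewrite ler_wpM2l.
(* After factoring, the claim is that [expR B - expR A] times [1 - expR (- A - B)] is
   nonnegative. *)
have -> : expR (- A) = expR B * expR (- A - B).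
  by rewrite -expRD; congr expR; ring.
have -> : expR (- B) = expR A * expR (- A - B).
  by rewrite -expRD; congr expR; ring.
have h1 : expR A <= expR B by rewrite ler_expR.
have h2 : expR (- A - B) <= 1 by rewrite -expR0 ler_expR; lra.
by nra.
Qed.

(** * The conditional step-up inequality *)

Section conditional_stepup.
Context (R : realType) (m : R).
Local Notation L := (@lebesgue_R R).
Local Notation nu := (student_dist m).
Hypothesis chi2T : chi2_dist m [set: R] = 1%E.
Hypothesis m0 : 0 < m.
Variable theta : R.
Local Open Scope ereal_scope.

Lemma ge0_integral_sym (f : R -> \bar R) :
  measurable_fun [set: R] f -> (forall x, 0 <= f x) ->
  \int[L]_x f x = \int[L]_x (2^-1%:E * (f x + f (- x)%R)).
Proof.
move=> mf f0.
have mfN : measurable_fun [set: R] (fun x => f (- x)%R) by exact: measurableT_comp.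
rewrite ge0_integralZl//; last 2 first.
- exact: emeasurable_funD.
- by move=> x _; rewrite adde_ge0.
rewrite ge0_integralD// -ge0_integral_opp// -mule2n -mule_natl muleA -EFinM.
by rewrite mulVf ?mul1e// pnatr_eq0.
Qed.

(* The likelihood ratio of [N(theta, 1)] to [N(0, 1)] at [t], symmetrized in [b]. *)
Definition tilt (s b : R) : R :=
  let t := (b * Num.sqrt (s / (1 + b ^+ 2)))%R in
  (2^-1 * (expR (theta * t - theta ^+ 2 / 2) + expR (- (theta * t) - theta ^+ 2 / 2)))%R.

Lemma measurable_tilt s : measurable_fun [set: R] (tilt s).
Proof. rewrite /tilt; meas. Qed.

Lemma tilt_ge0 s b : (0 <= tilt s b)%R.
Proof. by rewrite mulr_ge0// addr_ge0 ?expR_ge0. Qed.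

(** For fixed [s] the square of [u] equals [s * (1 - (1 + b ^+ 2)^-1)], which grows with [|b|]. The
    symmetrized ratio is a positive multiple of the hyperbolic cosine of [theta * u]. *)
Lemma ler_tilt s b c : (0 < s)%R -> (`|b| <= `|c|)%R -> (tilt s b <= tilt s c)%R.
Proof.
move=> s0 bc.
have tiltE (x : R) : tilt s x = (2^-1 * (expR (- (theta ^+ 2 / 2)) *
    (expR (theta * (`|x| * Num.sqrt (s / (1 + x ^+ 2)))) +
     expR (- (theta * (`|x| * Num.sqrt (s / (1 + x ^+ 2))))))))%R.
  rewrite /tilt; congr (_ * _)%R; rewrite mulrDr -!expRD.
  have [x0|x0] := leP 0%R x; first by rewrite ger0_norm// !(addrC (- (theta ^+ 2 / 2))%R).
  rewrite ltr0_norm//; by rewrite addrC !(addrC (- (theta ^+ 2 / 2))%R) !mulNr !mulrN opprK.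
rewrite !tiltE ler_pM2l// ler_pM2l ?expR_gt0//; apply: ler_cosh.
have tE (x : R) : (`|x| * Num.sqrt (s / (1 + x ^+ 2)) = Num.sqrt (s * (1 - (1 + x ^+ 2)^-1)))%R.
  rewrite -sqrtr_sqr -sqrtrM ?sqr_ge0//; congr Num.sqrt.
  by field; rewrite gt_eqF// onesqr_gt0.
rewrite mulr_ge0//= !tE ler_wsqrtr// ler_pM2l// lerB// lef_pV2 ?posrE ?onesqr_gt0//.
by rewrite lerD2l ler_sqr_norm.
Qed.

(** Once the likelihood ratio is split off, everything else is even in [b] at fixed [s]. Averaging
    over [b] and [- b] then replaces the ratio, monotone in [u], by [tilt], monotone in [|b|]. *)
Lemma ge0_integral_shifted_ratio (Phi : R * R -> R) :
  measurable_fun [set: R * R] Phi -> (forall z, (0 <= Phi z)%R) ->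
  (forall u w, Phi ((- u)%R, w) = Phi (u, w)) ->
  \int[L]_w \int[L]_u (Phi (u, w) * expR (- (u - theta) ^+ 2 / 2) * chi2_pdf m w)%:E =
  \int[L]_s (\int[nu]_b (Phi (b * Num.sqrt (s / (1 + b ^+ 2)), s / (1 + b ^+ 2)) * tilt s b)%R%:E *
    (\int[L]_b (student_kernel m b)%:E * (scale_kernel m s)%:E)).
Proof.
move=> mPhi Phi0 PhiN.
pose G (z : R * R) := (Phi z * expR (theta * z.1 - theta ^+ 2 / 2))%:E.
have mG : measurable_fun [set: R * R] G by unfold G; meas.
have G0 z : 0 <= G z by rewrite lee_fin mulr_ge0 ?expR_ge0.
transitivity (\int[L]_w \int[L]_u (G (u, w) * (expR (- u ^+ 2 / 2) * chi2_pdf m w)%:E)).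
  apply: eq_integral => w _; apply: eq_integral => u _.
  have -> : (expR (- (u - theta) ^+ 2 / 2) = expR (- u ^+ 2 / 2) * expR (theta * u - theta ^+ 2 / 2))%R.
    by rewrite -expRD; congr expR; field.
  by rewrite /G -EFinM /=; congr EFin; ring.
rewrite ge0_integral_student//; apply: eq_integral => s _.
set K := \int[L]_b (student_kernel m b)%:E.
pose w b := (s / (1 + b ^+ 2))%R.
pose t b := (b * Num.sqrt (w b))%R.
have wN b : w (- b)%R = w b by rewrite /w sqrrN.
have tN b : t (- b)%R = (- t b)%R by rewrite /t wN mulNr.
have mw : measurable_fun [set: R] w by unfold w; meas.
have mt : measurable_fun [set: R] t by unfold t; meas.
have mtilt := measurable_tilt s.
have mpdf := measurable_student_pdf m.
have kN b : student_kernel m (- b)%R = student_kernel m b by rewrite /student_kernel sqrrN.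
have K0 : 0 <= K by apply: integral_ge0 => b _; rewrite lee_fin ltW ?student_kernel_gt0.
rewrite ge0_integral_sym; last 2 first.
- meas.
- by move=> b; rewrite mule_ge0// lee_fin mulr_ge0 ?scale_kernel_ge0// ltW ?student_kernel_gt0.
rewrite ge0_integral_student_dist; last 2 first.
- meas.
- by move=> b; rewrite lee_fin mulr_ge0 ?tilt_ge0.
rewrite -ge0_integralZr//; last 3 first.
- meas.
- by move=> b _; rewrite mule_ge0 ?lee_fin ?student_pdf_ge0// mulr_ge0 ?tilt_ge0.
- by rewrite mule_ge0// lee_fin scale_kernel_ge0.
apply: eq_integral => b _.
transitivity ((Phi (t b, w b) * tilt s b * (student_kernel m b * scale_kernel m s))%:E); last first.
  rewrite EFinM (EFinM (student_kernel m b)) (student_kernelE chi2T b) -/K.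
  by rewrite !muleA.
have GE x y (c : R) : G (x, y) * c%:E =
    (Phi (x, y) * expR (theta * x - theta ^+ 2 / 2) * c)%:E by rewrite /G -EFinM.
rewrite kN !GE -EFinD -EFinM; congr EFin.
rewrite -/(w b) -/(w (- b)%R) wN /= mulNr -/(t b) PhiN mulrN /tilt -/(w b) -/(t b).
by ring.
Qed.

Variables (q : R -> R) (a : R) (r : R -> nat).
Hypothesis qE : forall x : R, (q x)%:E = nu [set b | (x <= m * b ^+ 2)%R].
Hypothesis qa : nu [set b | (q (m * b ^+ 2) <= a)%R] = a%:E.
Hypothesis a0 : (0 < a)%R.
Hypothesis r0 : forall w, (0 < r w)%N.
Hypothesis r_anti : forall v w : R, (0 < v <= w)%R -> (r w <= r v)%N.
Hypothesis mr : measurable_fun [set: R * R] (fun z : R * R =>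
  (if q (m * z.1 ^+ 2 / z.2) <= (r z.2)%:R * a then (r z.2)%:R^-1 else 0)%R : R).

Lemma conditional_stepup_le :
  \int[L]_w \int[L]_u ((if q (m * u ^+ 2 / w) <= (r w)%:R * a then (r w)%:R^-1 else 0)
     * expR (- (u - theta) ^+ 2 / 2) * chi2_pdf m w)%R%:E <=
  \int[L]_w \int[L]_u ((if q (m * u ^+ 2 / w) <= a then 1 else 0)
     * expR (- (u - theta) ^+ 2 / 2) * chi2_pdf m w)%R%:E.
Proof.
have mq := measurable_pvalue qE.
pose P1 (z : R * R) : R := (if q (m * z.1 ^+ 2 / z.2) <= (r z.2)%:R * a then (r z.2)%:R^-1 else 0)%R.
pose P2 (z : R * R) : R := (if q (m * z.1 ^+ 2 / z.2) <= a then 1 else 0)%R.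
have mP2 : measurable_fun [set: R * R] P2 by unfold P2; meas.
have P10 z : (0 <= P1 z)%R by rewrite /P1; case: ifP.
have P20 z : (0 <= P2 z)%R by rewrite /P2; case: ifP.
have P1N u w : P1 ((- u)%R, w) = P1 (u, w) by rewrite /P1 /= sqrrN.
have P2N u w : P2 ((- u)%R, w) = P2 (u, w) by rewrite /P2 /= sqrrN.
have mP1 : measurable_fun [set: R * R] P1 by [].
rewrite [leLHS](ge0_integral_shifted_ratio mP1 P10 P1N).
rewrite [leRHS](ge0_integral_shifted_ratio mP2 P20 P2N).
have K0 : 0 <= \int[L]_b (student_kernel m b)%:E.
  by apply: integral_ge0 => b _; rewrite lee_fin ltW ?student_kernel_gt0.
(* The comparison holds for each [s] separately, as the factor carrying the law of [s] is common to
   both sides. *)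
apply: ge0_le_integral_nonmeas => s.
  rewrite mule_ge0// ?mule_ge0 ?lee_fin ?scale_kernel_ge0//.
  by apply: integral_ge0 => b _; rewrite lee_fin mulr_ge0 ?tilt_ge0.
have [s0|s0] := ltP 0%R s; last first.
  by rewrite /scale_kernel ltNge s0 /= !mule0.
apply: lee_wpmul2r; first by rewrite mule_ge0// lee_fin scale_kernel_ge0.
have ratioE b : (m * (b * Num.sqrt (s / (1 + b ^+ 2))) ^+ 2 / (s / (1 + b ^+ 2)) = m * b ^+ 2)%R.
  rewrite exprMn sqr_sqrtr; last by rewrite divr_ge0// ltW// onesqr_gt0.
  by field; rewrite !gt_eqF// onesqr_gt0.
pose rr b := r (s / (1 + b ^+ 2))%R.
have -> : \int[nu]_b (P2 (b * Num.sqrt (s / (1 + b ^+ 2)), s / (1 + b ^+ 2)) * tilt s b)%R%:E =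
    \int[nu]_(b in [set b | (q (m * b ^+ 2) <= a)%R]) (tilt s b)%:E.
  rewrite [RHS]integral_mkcond; apply: eq_integral => b _.
  rewrite /P2 /= ratioE patchE; case: ifPn => qb.
    by rewrite mem_set// mul1r.
  by rewrite memNset ?mul0r//; exact/negP.
have -> : \int[nu]_b (P1 (b * Num.sqrt (s / (1 + b ^+ 2)), s / (1 + b ^+ 2)) * tilt s b)%R%:E =
    \int[nu]_b (if q (m * b ^+ 2) <= (rr b)%:R * a then (rr b)%:R^-1 * tilt s b else 0)%R%:E.
  apply: eq_integral => b _; rewrite /P1 /= ratioE.
  by case: ifP => _; rewrite ?mul0r.
pose qq (b : R) := q (m * b ^+ 2)%R.
apply: (@integral_comonotone_le _ _ _ nu qq (tilt s) rr a) => //; rewrite /qq.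
- by meas.
- exact: measurable_tilt.
- by move=> b; exact: tilt_ge0.
- by move=> b; exact: r0.
- by move=> b c; rewrite (pvalue_sqr_le chi2T m0 qE) => /(ler_tilt s0).
- move=> b c; rewrite (pvalue_sqr_le chi2T m0 qE) => cb; apply: r_anti.
  rewrite divr_gt0 ?onesqr_gt0//= ler_pM2l// lef_pV2 ?posrE ?onesqr_gt0//.
  by rewrite lerD2l ler_sqr_norm.
- move=> k; apply: (student_dist_pvalue_le m0 qE).
  by rewrite mulr_ge0// ltW.
Qed.

End conditional_stepup.

(** * The step-up rule *)

Section stepup.
Context (R : realType) (d : nat).

Definition n_le (p : 'I_d -> R) (c : R) : nat := #|finset (fun j => p j <= c)|.

(** Trading sorted values for counts is what permits leaving one coordinate out. *)
Lemma order_stat_leE (p : 'I_d -> R) (c : R) (k : nat) : (0 < k <= d)%N ->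
  (order_stat p k <= c) = (k <= n_le p c)%N.
Proof.
move=> /andP[k0 kd]; rewrite /order_stat /n_le.
set s := sort <=%R (codom p).
have szs : size s = d by rewrite size_sort size_codom card_ord.
have ss : sorted <=%R s by exact: sort_le_sorted.
have -> : #|finset (fun j => p j <= c)| = count (fun x => x <= c) s.
  rewrite (permP (permEl (perm_sort _ _))) /codom /image_mem count_map cardE.
  rewrite size_filter -enumT; apply: eq_count => j /=; by rewrite inE.
have nth_le i j : (i <= j < d)%N -> s`_i <= s`_j.
  move=> /andP[ij jd]; apply: (sorted_leq_nth le_trans le_refl 0 ss) => //;
    by rewrite inE szs // (leq_ltn_trans ij).
apply/idP/idP => [sk|].
  rewrite -(cat_take_drop k s) count_cat.
  have -> : count (fun x => x <= c) (take k s) = k.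
    have szk : size (take k s) = k by rewrite size_takel// szs.
    rewrite -[RHS]szk; apply/eqP; rewrite -all_count; apply/(all_nthP 0) => i.
    rewrite szk => ik; rewrite nth_take//; apply: le_trans sk; apply: nth_le.
    by rewrite -ltnS prednK// ik (leq_trans _ kd).
  exact: leq_addr.
apply: contraTT; rewrite -ltNge -ltnNge => ck.
(* Order statistics are indexed from 1, so the [k]-th one heads [drop k.-1 s]. Once it exceeds [c],
   so do all entries after it. *)
rewrite -(cat_take_drop k.-1 s) count_cat.
have -> : count (fun x => x <= c) (drop k.-1 s) = 0%N.
  apply/eqP; rewrite -leqn0 leqNgt -has_count; apply/hasPn => x /(nthP 0)[i].
  rewrite size_drop szs ltn_subRL => id <-; rewrite nth_drop -ltNge.
  by apply: lt_le_trans ck _; apply: nth_le; rewrite leq_addr.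
rewrite addn0 (leq_ltn_trans (count_size _ _))// size_takel; first by rewrite prednK.
by rewrite szs (leq_trans (leq_pred _)).
Qed.

Lemma bigmax_nat_mem (P : pred nat) (n : nat) :
  let M := (\max_(1 <= k < n.+1 | P k) k)%N in
  M = 0%N \/ (0 < M <= n)%N /\ P M.
Proof.
move=> M; rewrite /M big_nat_cond.
elim/big_ind: _ => [|x y hx hy|k /andP[]]; first by left.
  by rewrite /maxn; case: ifP.
by right.
Qed.

Lemma leq_bigmax_nat (P : pred nat) (n k : nat) : (0 < k <= n)%N -> P k ->
  (k <= \max_(1 <= k < n.+1 | P k) k)%N.
Proof. by move=> kn Pk; apply: leq_bigmax_seq => //; rewrite mem_index_iota. Qed.

Variable a : R.
Hypothesis a0 : 0 <= a.

(** The bounds concern the number of rejections, the denominator of the false discovery proportion,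
    rather than the step-up index [rho]. Rejecting up to the [rho]-th order statistic gives at least
    [rho] rejections, and both bounds follow from that. *)
Lemma stepup_reject_cond (p : 'I_d -> R) (i : 'I_d) :
  let rej := stepup_reject (fun k => k%:R * a) p in
  i \in rej ->
  [/\ (0 < #|rej| <= d)%N, (forall j, j \in rej -> p j <= #|rej|%:R * a) &
     forall k, (0 < k <= d)%N -> (k <= n_le p (k%:R * a))%N -> (k <= #|rej|)%N].
Proof.
rewrite /stepup_reject; case: (@bigmax_nat_mem (fun k => order_stat p k <= k%:R * a) d).
  by rewrite -/(stepup_index (fun k => k%:R * a) p) => ->; rewrite eqxx inE.
rewrite -/(stepup_index (fun k => k%:R * a) p).
set rho := stepup_index _ _ => -[/andP[rho0 rhod] Prho].
rewrite gtn_eqF// => ip.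
set rej := finset _; set n := #|rej|.
have nE : n = n_le p (order_stat p rho) by [].
have rhon : (rho <= n)%N by rewrite nE -order_stat_leE// rho0.
have nd : (n <= d)%N by rewrite -[leqRHS]card_ord max_card.
have n0 : (0 < n)%N by exact: leq_trans rhon.
have rejP j : j \in rej -> p j <= n%:R * a.
  rewrite inE => /le_trans; apply; apply: le_trans Prho _.
  by rewrite ler_wpM2r// ler_nat.
split => //; first by rewrite n0.
move=> k kd kn; apply: leq_trans rhon.
apply: leq_bigmax_nat => //.
by rewrite order_stat_leE.
Qed.

(* The number of rejections were [p i] replaced by [0]. *)
Definition loo_index (p : 'I_d -> R) (i : 'I_d) : nat :=
  (\max_(1 <= k < d.+1 |
     k <= #|finset (fun j => (j != i) && (p j <= k%:R * a)%R)|.+1) k)%N.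

Lemma loo_index_gt0 p i : (0 < loo_index p i)%N.
Proof. by apply: leq_bigmax_nat => //; apply: leq_ltn_trans (ltn_ord i). Qed.

Lemma loo_index_anti p p' i : (forall j, j != i -> p j <= p' j) ->
  (loo_index p' i <= loo_index p i)%N.
Proof.
move=> pp'; rewrite /loo_index.
case: (@bigmax_nat_mem (fun k => k <= #|finset (fun j => (j != i) && (p' j <= k%:R * a)%R)|.+1)%N d) => [->//|].
set M := (\max_(_ <= _ < _ | _) _)%N => -[Md PM].
apply: leq_bigmax_nat => //; apply: (leq_trans PM); rewrite ltnS.
apply/subset_leq_card/fintype.subsetP => j; rewrite !inE => /andP[ji pj].
by rewrite ji (le_trans _ pj)// pp'.
Qed.

Lemma n_leE p i (c : R) : p i <= c ->
  n_le p c = #|finset (fun j => (j != i) && (p j <= c)%R)|.+1.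
Proof.
move=> pic; rewrite /n_le (cardsD1 i) inE pic add1n; congr _.+1.
by apply: eq_card => j; rewrite !inE.
Qed.

(** If [i] is rejected, [p i] lies below the thresholds of both counts, so replacing it by 0 changes
    neither tally. Each count is then feasible in the maximization that defines the other. *)
Lemma stepup_reject_loo (p : 'I_d -> R) (i : 'I_d) :
  let rej := stepup_reject (fun k => k%:R * a) p in
  i \in rej -> p i <= (loo_index p i)%:R * a /\ #|rej| = loo_index p i.
Proof.
move=> rej irej; have [/andP[n0 nd] rejP nmax] := stepup_reject_cond irej.
have pin := rejP _ irej.
have nloo : (#|rej| <= loo_index p i)%N.
  apply: leq_bigmax_nat; first by rewrite n0.
  rewrite -n_leE//; apply/subset_leq_card/fintype.subsetP => j /rejP.
  by rewrite inE.
have pil : p i <= (loo_index p i)%:R * a.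
  by apply: (le_trans pin); rewrite ler_wpM2r// ler_nat.
split => //; apply/eqP; rewrite eqn_leq nloo /=.
case: (@bigmax_nat_mem (fun k => k <= #|finset (fun j => (j != i) && (p j <= k%:R * a)%R)|.+1)%N d).
  by rewrite -/(loo_index p i) => ->.
rewrite -/(loo_index p i) => -[loord loop].
by apply: nmax => //; rewrite (n_leE pil).
Qed.

Definition loo_weight (p : 'I_d -> R) (i : 'I_d) : R :=
  if p i <= (loo_index p i)%:R * a then (loo_index p i)%:R^-1 else 0.

Lemma loo_weight_ge0 p i : 0 <= loo_weight p i.
Proof. by rewrite /loo_weight; case: ifP. Qed.

Lemma fdp_le (p : 'I_d -> R) (H0 rej : {set 'I_d}) :
  rej = stepup_reject (fun k => k%:R * a) p ->
  #|(rej :&: H0)%SET|%:R / (maxn #|rej| 1)%:R <=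
  \sum_(i in H0) loo_weight p i.
Proof.
move=> rejE.
rewrite -sum1_card natr_sum mulr_suml big_mkcond [leRHS]big_mkcond /=.
apply: ler_sum => i _; rewrite inE.
case: (i \in H0); last by rewrite andbF.
rewrite andbT; case: ifPn => [irej|_]; last exact: loo_weight_ge0.
have [pir nr] : p i <= (loo_index p i)%:R * a /\ #|rej| = loo_index p i.
  by move: irej; rewrite rejE; exact: stepup_reject_loo.
rewrite /loo_weight pir -nr.
have n0 : (0 < #|rej|)%N by rewrite card_gt0; apply/set0Pn; exists i.
by rewrite (maxn_idPl _)// mul1r.
Qed.

End stepup.

(** A function of finitely many booleans is a finite sum, over all boolean patterns, of constants
    times products of indicators. *)
Lemma measurable_fun_finbool dT (T : measurableType dT) (R : realType)
    (I : finType) (b : I -> T -> bool) (G : {ffun I -> bool} -> R) :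
  (forall e, measurable_fun [set: T] (b e)) ->
  measurable_fun [set: T] (fun z => G [ffun e => b e z]).
Proof.
move=> mb.
have -> : (fun z => G [ffun e => b e z]) = (fun z => \sum_(beta : {ffun I -> bool})
    (\prod_(e : I) (if b e z == beta e then 1 else 0)) * G beta).
  apply/funext => z; rewrite (bigD1 [ffun e => b e z])//=.
  rewrite big1 ?mul1r; last by move=> e _; rewrite ffunE eqxx.
  rewrite big1 ?addr0// => beta; rewrite -[beta == _]negbK => /negP bz.
  have [e be] : exists e, b e z != beta e.
    apply/existsP; apply: contrapT => /negP; rewrite negb_exists => /forallP h.
    apply: bz; rewrite negbK; apply/eqP/ffunP => e; rewrite ffunE.
    by have := h e; rewrite negbK => /eqP.
  by rewrite (bigD1 e)//= (negbTE be) !mul0r.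
apply: measurable_sum => beta; apply: measurable_funM => //.
apply: measurable_prod => e _.
rewrite (_ : (fun z => _) = (fun z => if b e z then (beta e)%:R else (~~ beta e)%:R)).
  exact: measurable_fun_ifT.
by apply/funext => z; case: (b e z); case: (beta e).
Qed.

(** The weight depends on the p-values only through the finitely many comparisons [p j <= k * a]
    with [k <= d]. The levels are indexed by ['I_d.+1], and [inord] loses nothing because
    [loo_index] is at most [d]. *)
Lemma measurable_loo_weight dT (T : measurableType dT) (R : realType) (d : nat)
    (a : R) (p : 'I_d -> T -> R) (i : 'I_d) :
  (forall j, measurable_fun [set: T] (p j)) ->
  measurable_fun [set: T] (fun z => loo_weight a (p^~ z) i).
Proof.
move=> mp.
pose b (e : 'I_d * 'I_d.+1) z := p e.1 z <= (e.2)%:R * a.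
pose loo (beta : {ffun 'I_d * 'I_d.+1 -> bool}) :=
  (\max_(1 <= k < d.+1 |
    k <= #|finset (fun j => (j != i) && beta (j, inord k))|.+1) k)%N.
pose G (beta : {ffun 'I_d * 'I_d.+1 -> bool}) : R :=
  if beta (i, inord (loo beta)) then (loo beta)%:R^-1 else 0.
have -> : (fun z => loo_weight a (p^~ z) i) = (fun z => G [ffun e => b e z]).
  apply/funext => z; rewrite /loo_weight /G.
  have -> : loo [ffun e => b e z] = loo_index a (p^~ z) i.
    rewrite /loo /loo_index big_nat_cond [RHS]big_nat_cond; apply: eq_bigl => k.
    case kd : (1 <= k < d.+1)%N => //=; congr (_ <= _.+1)%N.
    apply: eq_card => j; rewrite !inE ffunE /b /= inordK//.
    by case/andP: kd.
  rewrite ffunE /b /= inordK//.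
  rewrite /loo_index; case: (@bigmax_nat_mem (fun k => k <= #|finset (fun j => (j != i) && (p j z <= k%:R * a)%R)|.+1)%N d) => [->//|[/andP[_ h] _]].
  by rewrite ltnS.
apply: measurable_fun_finbool => e; rewrite /b.
exact: measurable_fun_ler.
Qed.

(** * The multivariate normal distribution *)

Section lebesgue_tuple_theory.
Context (R : realType).
Local Notation L := (@lebesgue_R R).
Local Open Scope ereal_scope.

Lemma ge0_integral_lebesgue_tupleS n (f : n.+1.-tuple R -> \bar R) :
  measurable_fun [set: n.+1.-tuple R] f -> (forall x, 0 <= f x) ->
  \int[lebesgue_tuple R n.+1]_x f x =
  \int[L]_y \int[lebesgue_tuple R n]_t f (cons_pair (y, t)).
Proof.
move=> mf f0.
transitivity (\int[pushforward (L \x lebesgue_tuple R n) (@cons_pair R n)]_x f x).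
  by [].
rewrite ge0_integral_pushforward//; last exact: measurable_cons_pair.
rewrite preimage_setT.
apply: (@fubini_tonelli1 _ _ _ _ _ L (lebesgue_tuple R n) (f \o @cons_pair R n)).
  by apply: measurableT_comp mf _; exact: measurable_cons_pair.
by move=> x; exact: f0.
Qed.

Lemma ge0_integral_lebesgue_tuple0 (f : 0.-tuple R -> \bar R) :
  measurable_fun [set: 0.-tuple R] f ->
  \int[lebesgue_tuple R 0]_x f x = f [tuple].
Proof. by move=> mf; rewrite integral_dirac// diracT mul1e. Qed.

Definition insert_tuple n (i : 'I_n.+1) (y : R) (t : n.-tuple R) : n.+1.-tuple R :=
  [tuple oapp (tnth t) y (unlift i k) | k < n.+1].

Lemma tnth_insert_same n (i : 'I_n.+1) y (t : n.-tuple R) :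
  tnth (insert_tuple i y t) i = y.
Proof. by rewrite tnth_mktuple unlift_none. Qed.

Lemma tnth_insert_lift n (i : 'I_n.+1) y (t : n.-tuple R) j :
  tnth (insert_tuple i y t) (lift i j) = tnth t j.
Proof. by rewrite tnth_mktuple liftK. Qed.

Lemma tnth_cons_pair0 n y (t : n.-tuple R) : tnth (cons_pair (y, t)) ord0 = y.
Proof. by rewrite (tnth_nth y). Qed.

Lemma tnth_cons_pairS n y (t : n.-tuple R) j :
  tnth (cons_pair (y, t)) (lift ord0 j) = tnth t j.
Proof. by rewrite (tnth_nth y) (tnth_nth y). Qed.

Lemma insert_tuple0 n y (t : n.-tuple R) : insert_tuple ord0 y t = cons_pair (y, t).
Proof.
apply: eq_from_tnth => k; case: (unliftP ord0 k) => [j ->|->].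
  by rewrite tnth_insert_lift tnth_cons_pairS.
by rewrite tnth_insert_same tnth_cons_pair0.
Qed.

Lemma insert_tuple_lift n (j : 'I_n.+1) y a (t : n.-tuple R) :
  insert_tuple (lift ord0 j) y (cons_pair (a, t)) = cons_pair (a, insert_tuple j y t).
Proof.
apply: eq_from_tnth => k; case: (unliftP (lift ord0 j) k) => [l ->|->]; last first.
  by rewrite tnth_insert_same tnth_cons_pairS tnth_insert_same.
rewrite tnth_insert_lift; case: (unliftP ord0 l) => [e ->|->].
  rewrite tnth_cons_pairS.
  have -> : lift (lift ord0 j) (lift ord0 e) = lift ord0 (lift j e).
    by apply/val_inj; rewrite /= /bump /= !add1n ltnS addnS.
  by rewrite tnth_cons_pairS tnth_insert_lift.
have -> : lift (lift ord0 j) ord0 = ord0 by exact/val_inj.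
by rewrite !tnth_cons_pair0.
Qed.

Lemma measurable_insert_tuple n (i : 'I_n.+1) :
  measurable_fun [set: R * n.-tuple R] (fun z => insert_tuple i z.1 z.2).
Proof.
apply/measurable_fun_tnthP => k.
rewrite (_ : _ \o _ = fun z : R * n.-tuple R => oapp (tnth z.2) z.1 (unlift i k)).
  case: (unlift i k) => [j|] /=; last exact: measurable_fst.
  by apply: (measurableT_comp (measurable_tnth j)).
by apply/funext => z /=; rewrite tnth_mktuple.
Qed.

(** [lebesgue_tuple] peels coordinates off the front. Induction passes the leading ones until [i] is
    in front, and Tonelli then moves it innermost. *)
Lemma ge0_integral_insert n (i : 'I_n.+1) (f : n.+1.-tuple R -> \bar R) :
  measurable_fun [set: n.+1.-tuple R] f -> (forall x, 0 <= f x) ->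
  \int[lebesgue_tuple R n.+1]_x f x =
  \int[lebesgue_tuple R n]_t \int[L]_y f (insert_tuple i y t).
Proof.
have mfi k (j : 'I_k.+1) g : measurable_fun [set: k.+1.-tuple R] g ->
    measurable_fun [set: R * k.-tuple R] (fun z => g (insert_tuple j z.1 z.2) : \bar R).
  by move=> mg; apply: measurableT_comp mg _; exact: measurable_insert_tuple.
elim: n i f => [|n IHn] i f mf f0.
  rewrite (ord1 i) ge0_integral_lebesgue_tupleS// ge0_integral_lebesgue_tuple0; last first.
    apply: (measurable_fun_fubini_tonelli_G _ (mfi _ ord0 _ mf)) => z; exact: f0.
  apply: eq_integral => y _; rewrite ge0_integral_lebesgue_tuple0.
    by rewrite -insert_tuple0.
  by apply: measurableT_comp mf _; apply: (measurableT_comp (@measurable_cons_pair R 0)).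
case: (unliftP ord0 i) => [j ->|->]; last first.
  rewrite ge0_integral_lebesgue_tupleS//.
  rewrite (@fubini_tonelli _ _ _ _ _ L (lebesgue_tuple R n.+1) (fun z => f (cons_pair z)))//.
    by apply: eq_integral => t _; apply: eq_integral => y _; rewrite insert_tuple0.
  by apply: measurableT_comp mf _; exact: measurable_cons_pair.
rewrite ge0_integral_lebesgue_tupleS// [RHS]ge0_integral_lebesgue_tupleS; last 2 first.
- exact: (measurable_fun_fubini_tonelli_G _ (mfi _ (lift ord0 j) _ mf)).
- by move=> t; exact: integral_ge0.
apply: eq_integral => a _.
rewrite (IHn j)//; last first.
  apply: measurableT_comp mf _.
  by apply: (measurableT_comp (@measurable_cons_pair R n.+1)).
by apply: eq_integral => t _; apply: eq_integral => y _; rewrite insert_tuple_lift.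
Qed.

Definition shift_tuple n (c : 'I_n -> R) (t : n.-tuple R) : n.-tuple R :=
  [tuple (tnth t j + c j)%R | j < n].

Lemma measurable_shift_tuple n (c : 'I_n -> R) :
  measurable_fun [set: n.-tuple R] (shift_tuple c).
Proof.
apply/measurable_fun_tnthP => k.
rewrite (_ : _ \o _ = fun t : n.-tuple R => (tnth t k + c k)%R).
  by apply: measurable_funD => //; exact: measurable_tnth.
by apply/funext => z /=; rewrite tnth_mktuple.
Qed.

Lemma ge0_integral_shift_tuple n (c : 'I_n -> R) (f : n.-tuple R -> \bar R) :
  measurable_fun [set: n.-tuple R] f -> (forall x, 0 <= f x) ->
  \int[lebesgue_tuple R n]_t f (shift_tuple c t) = \int[lebesgue_tuple R n]_t f t.
Proof.
elim: n c f => [|n IHn] c f mf f0.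
  rewrite !ge0_integral_lebesgue_tuple0//; first by congr f; exact: tuple0.
  by apply: measurableT_comp mf _; exact: measurable_shift_tuple.
rewrite !ge0_integral_lebesgue_tupleS//; last first.
  by apply: measurableT_comp mf _; exact: measurable_shift_tuple.
have mfc : measurable_fun [set: R * n.-tuple R] (fun z => f (cons_pair z)).
  by apply: measurableT_comp mf _; exact: measurable_cons_pair.
rewrite [RHS](ge0_integral_affine (c ord0) ltr01); last 2 first.
- exact: (measurable_fun_fubini_tonelli_F _ mfc).
- by move=> y; exact: integral_ge0.
rewrite mul1e; apply: eq_integral => y _.
rewrite -[RHS](IHn (fun j => c (lift ord0 j)))//; last first.
  by apply: measurableT_comp mf _; apply: (measurableT_comp (@measurable_cons_pair R n)).
apply: eq_integral => t _; congr f; apply: eq_from_tnth => k.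
rewrite tnth_mktuple mul1r; case: (unliftP ord0 k) => [j ->|->].
  by rewrite !tnth_cons_pairS tnth_mktuple.
by rewrite !tnth_cons_pair0.
Qed.

End lebesgue_tuple_theory.

(** * Quadratic forms and Schur complements *)

Section quadratic_form.
Context (R : realType).

Definition quad n (A : 'M[R]_n) (v : 'cV[R]_n) : R := (v^T *m A *m v) 0 0.

Lemma quadDZ n (A : 'M[R]_n) (x : R) (v w : 'cV[R]_n) : A^T = A ->
  quad A (x *: v + w) = x ^+ 2 * quad A v + 2 * x * (w^T *m A *m v) 0 0 + quad A w.
Proof.
move=> AT; rewrite /quad.
have sym : v^T *m A *m w = (w^T *m A *m v)^T.
  by rewrite !trmx_mul AT trmxK mulmxA.
have -> : (x *: v + w)^T = x *: v^T + w^T by rewrite linearD linearZ.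
rewrite !mulmxDl !mulmxDr -!scalemxAl -!scalemxAr scalerA sym.
rewrite !mxE; ring.
Qed.

Lemma posdef_unitmx n (S : 'M[R]_n) : posdef S -> S \in unitmx.
Proof.
move=> [ST Spos]; rewrite -row_free_unit; apply: inj_row_free => v vS.
apply/eqP; rewrite -[v == 0]negbK; apply/negP => v0.
have := Spos v^T; rewrite trmxK vS mul0mx mxE ltxx => h.
by apply: (_ : ~ false) (h _) => //; rewrite -(inj_eq trmx_inj) trmxK trmx0.
Qed.

Lemma posdef_invmx n (S : 'M[R]_n) : posdef S -> posdef (invmx S).
Proof.
move=> Sp; have [ST Spos] := Sp; have uS := posdef_unitmx Sp.
have iST : (invmx S)^T = invmx S by rewrite trmx_inv ST.
split => // v v0.
have -> : v^T *m invmx S *m v = (invmx S *m v)^T *m S *m (invmx S *m v).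
  by rewrite trmx_mul iST mulmxKV// mulmxA.
apply: Spos; apply: contra v0 => /eqP Sv0; apply/eqP.
by rewrite -(mul1mx v) -(mulmxV uS) -mulmxA Sv0 mulmx0.
Qed.

Lemma posdefZ n (S : 'M[R]_n) (c : R) : 0 < c -> posdef S -> posdef (c *: S).
Proof.
move=> c0 [ST Spos]; split; first by rewrite linearZ /= ST.
by move=> v v0; rewrite -scalemxAr -scalemxAl mxE mulr_gt0// Spos.
Qed.

Definition insert_col n (i : 'I_n.+1) (u : R) (z : 'cV[R]_n) : 'cV[R]_n.+1 :=
  \col_k oapp (fun j => z j 0) u (unlift i k).

Lemma insert_col_same n (i : 'I_n.+1) u z : insert_col i u z i 0 = u.
Proof. by rewrite mxE unlift_none. Qed.

Lemma insert_col_lift n (i : 'I_n.+1) u z j : insert_col i u z (lift i j) 0 = z j 0.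
Proof. by rewrite mxE liftK. Qed.

Lemma quad_delta n (A : 'M[R]_n) i : quad A (delta_mx i 0) = A i i.
Proof. by rewrite /quad trmx_delta -rowE -colE !mxE. Qed.

Lemma posdef_diag_gt0 n (S : 'M[R]_n) i : posdef S -> 0 < S i i.
Proof.
move=> [_ Spos]; rewrite -quad_delta; apply: Spos; apply/eqP => /matrixP/(_ i 0).
by rewrite !mxE !eqxx/= => /eqP; rewrite oner_eq0.
Qed.

Lemma insert_colE n (i : 'I_n.+1) u z (f : 'cV[R]_n.+1) : f i 0 = 1 ->
  insert_col i u z = u *: f + insert_col i 0 (z - u *: row' i f).
Proof.
move=> fi; apply/matrixP => k l; rewrite (ord1 l).
case: (unliftP i k) => [j ->|->]; rewrite [RHS]mxE ?insert_col_lift ?insert_col_same.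
  by rewrite !mxE addrC subrK.
by rewrite !mxE fi mulr1 addr0.
Qed.

Lemma row'_mul_insert0 n p (i : 'I_n.+1) (A : 'M[R]_(p, n.+1)) z :
  A *m insert_col i 0 z = col' i A *m z.
Proof.
apply/matrixP => k l; rewrite (ord1 l) !mxE (bigD1_ord i)//= insert_col_same mulr0 add0r.
by apply: eq_bigr => j _; rewrite insert_col_lift !mxE.
Qed.

Lemma quad_insert0 n (i : 'I_n.+1) (A : 'M[R]_n.+1) z :
  quad A (insert_col i 0 z) = quad (row' i (col' i A)) z.
Proof.
rewrite /quad -!mulmxA row'_mul_insert0 mxE (bigD1_ord i)//= !mxE unlift_none mul0r add0r.
apply: eq_bigr => j _; rewrite [in LHS]mxE insert_col_lift [in RHS]mxE; congr (_ * _).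
by rewrite !mxE; apply: eq_bigr => k _; rewrite !mxE.
Qed.

Lemma insert_col_eq0 n (i : 'I_n.+1) (z : 'cV[R]_n) : insert_col i 0 z = 0 -> z = 0.
Proof.
move=> z0; apply/matrixP => j l; rewrite (ord1 l) -(insert_col_lift i 0 z j) z0.
by rewrite !mxE.
Qed.

Lemma posdef_minor n (S : 'M[R]_n.+1) i : posdef S -> posdef (row' i (col' i S)).
Proof.
move=> [ST Spos]; split.
  by apply/matrixP => j k; rewrite !mxE -[in RHS]ST mxE.
move=> z z0; rewrite -[ltRHS]/(quad _ z) -quad_insert0; apply: Spos.
by apply: contra z0 => /eqP/insert_col_eq0 ->.
Qed.

(* Schur complement: [invmx S i i] is the inverse of the conditional variance of
   coordinate [i]. *)
Lemma posdef_multiple_corr2 n (S : 'M[R]_n.+1) i : posdef S ->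
  invmx S i i * S i i * (1 - multiple_corr2 S i) = 1.
Proof.
move=> Sp; have uS := posdef_unitmx Sp.
have Sii := posdef_diag_gt0 i Sp.
pose A := row' i (col' i S); have Ap : posdef A by exact: posdef_minor.
have uA := posdef_unitmx Ap.
pose s := row' i (col i S); pose o := row' i (col i (invmx S)).
(* Column [i] of [S *m invmx S = 1] is read blockwise: the rows other than [i] determine [o], and
   row [i] then gives the claim. *)
have colO : col i (invmx S) = invmx S i i *: delta_mx i 0 + insert_col i 0 o.
  apply/matrixP => k l; rewrite (ord1 l) [RHS]mxE.
  case: (unliftP i k) => [j ->|->].
    by rewrite insert_col_lift !mxE eq_sym (negbTE (neq_lift i j)) mulr0 add0r.
  by rewrite insert_col_same !mxE !eqxx mulr1 addr0.
have SO : invmx S i i *: col i S + col' i S *m o = delta_mx i 0.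
  rewrite -row'_mul_insert0 [X in _ *: X]colE scalemxAr -mulmxDr -colO.
  by rewrite [X in _ *m X]colE mulmxA mulmxV// mul1mx.
have Ao : A *m o = - invmx S i i *: s.
  apply/matrixP => j l; rewrite (ord1 l).
  have /matrixP/(_ (lift i j) 0) := SO; rewrite !mxE.
  rewrite eq_sym (negbTE (neq_lift i j)) /= => /eqP; rewrite addrC addr_eq0 => /eqP h.
  rewrite mulNr -h; apply: eq_bigr => k _; by rewrite !mxE.
have oE : o = - invmx S i i *: (invmx A *m s).
  by rewrite -(mulKmx uA o) Ao -scalemxAr.
have /matrixP/(_ i 0) := SO; rewrite [LHS]mxE [X in X + _]mxE [X in _ * X + _]mxE [in RHS]mxE !eqxx /=.
have -> : (col' i S *m o) i 0 = - invmx S i i * (s^T *m invmx A *m s) 0 0.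
  have symS k l : S k l = S l k by rewrite -[in LHS]Sp.1 mxE.
  transitivity ((s^T *m o) 0 0); last by rewrite oE -scalemxAr mulmxA mxE.
  rewrite mxE [RHS]mxE; apply: eq_bigr => k _; congr (_ * _).
  by rewrite !mxE symS.
move=> h; rewrite -[RHS]h /multiple_corr2 -/A -/s.
field; by rewrite gt_eqF.
Qed.

(** Completing the square in [u]: given the others, the centered coordinate [i] has mean
    [- b / O i i] and variance [(O i i)^-1]. *)
Lemma quad_conditional n (S : 'M[R]_n.+1) i u (z : 'cV[R]_n) : posdef S ->
  let O := invmx S in
  let b := (O *m insert_col i 0 z) i 0 in
  quad O (insert_col i u z) =
  O i i * (u + b / O i i) ^+ 2 + (quad O (insert_col i 0 z) - b ^+ 2 / O i i).
Proof.
move=> Sp O b; have Op := posdef_invmx Sp; have Oii := posdef_diag_gt0 i Op.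
have OT : O^T = O := Op.1.
rewrite (@insert_colE _ i u z (delta_mx i 0)); last by rewrite !mxE !eqxx.
rewrite quadDZ// quad_delta.
have -> : row' i (delta_mx i 0) = 0 :> 'cV[R]_n.
  by apply/matrixP => j l; rewrite !mxE eq_sym (negbTE (neq_lift i j)).
rewrite scaler0 subr0.
have -> : ((insert_col i 0 z)^T *m O *m (delta_mx i 0 : 'cV[R]_n.+1)) 0 0 = b.
  rewrite /b -colE mxE -[in LHS]OT -trmx_mul; exact: mxE.
by field; rewrite gt_eqF.
Qed.

(** For [f] the column [i] of [S] over [S i i], the vector [invmx S *m f] is a multiple of the unit
    vector, so its cross term with any vector vanishing at [i] is zero. What is left of [z] is its
    residual after regression on [u]. *)
Lemma quad_marginal n (S : 'M[R]_n.+1) i u (z : 'cV[R]_n) : posdef S ->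
  quad (invmx S) (insert_col i u z) =
  u ^+ 2 / S i i + quad (invmx S) (insert_col i 0 (z - (u / S i i) *: row' i (col i S))).
Proof.
move=> Sp; have Op := posdef_invmx Sp; have Sii := posdef_diag_gt0 i Sp.
have uS := posdef_unitmx Sp.
set O := invmx S; have OT : O^T = O := Op.1.
pose f := (S i i)^-1 *: col i S.
have fi : f i 0 = 1 by rewrite !mxE mulVf ?gt_eqF.
have Of : O *m f = (S i i)^-1 *: delta_mx i 0.
  by rewrite /f -scalemxAr [X in _ *m X]colE mulmxA mulVmx// mul1mx.
rewrite (insert_colE _ _ fi) quadDZ//.
have -> : quad O f = (S i i)^-1.
  rewrite /quad -mulmxA Of -scalemxAr mxE -colE !mxE.
  by rewrite mulVf ?mulr1// gt_eqF.
rewrite -mulmxA Of -scalemxAr mxE -colE !mxE unlift_none /= !mulr0 addr0.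
congr (_ + quad O (insert_col i 0 (_ - _))).
by apply/matrixP => j l; rewrite !mxE mulrA.
Qed.

End quadratic_form.

(** * Joint, conditional and marginal laws *)

Section joint_law.
Context (R : realType) (dT : measure_display) (T : measurableType dT)
  (P : probability T R).
Local Notation L := (@lebesgue_R R).

Lemma measurable_quad n (A : 'M[R]_n) dU (U : measurableType dU) (v : U -> 'cV[R]_n) :
  (forall k, measurable_fun [set: U] (fun x => v x k 0)) ->
  measurable_fun [set: U] (fun x => quad A (v x)).
Proof.
move=> mv; have -> : (fun x => quad A (v x)) =
    (fun x => \sum_j ((\sum_k v x k 0 * A k j) * v x j 0))%R.
  apply/funext => x; rewrite /quad mxE; apply: eq_bigr => j _; congr (_ * _)%R.
  by rewrite mxE; apply: eq_bigr => k _; rewrite mxE.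
apply: measurable_sum => j; apply: measurable_funM => //.
by apply: measurable_sum => k; apply: measurable_funM.
Qed.

Lemma measurable_mvnormal_pdf n (mu : 'cV[R]_n) (S : 'M[R]_n) :
  measurable_fun [set: n.-tuple R] (mvnormal_pdf mu S).
Proof.
apply: measurable_funM => //; apply: measurableT_comp => //.
apply: measurable_funM => //; apply: measurableT_comp => //.
apply: (@measurable_quad n (invmx S) _ _ (fun x : n.-tuple R => \col_i tnth x i - mu)%R) => k.
rewrite (_ : (fun _ => _) = (fun x : n.-tuple R => tnth x k - mu k 0)%R).
  by apply: measurable_funB => //; exact: measurable_tnth.
by apply/funext => x; rewrite !mxE.
Qed.

Lemma mvnormal_pdf_ge0 n (mu : 'cV[R]_n) (S : 'M[R]_n) x : (0 <= mvnormal_pdf mu S x)%R.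
Proof. by rewrite divr_ge0 ?expR_ge0 ?sqrtr_ge0. Qed.

Local Open Scope ereal_scope.

(** The joint law and the product of the marginals agree on rectangles, hence everywhere, and
    Tonelli applies. *)
Lemma ge0_integral_independent d1 d2 (T1 : measurableType d1) (T2 : measurableType d2)
    (X : {RV P >-> T1}) (Y : {RV P >-> T2}) (f : T1 * T2 -> \bar R) :
  independent_rv X Y -> measurable_fun [set: T1 * T2] f -> (forall z, 0 <= f z) ->
  \int[P]_x f (X x, Y x) = \int[distribution P Y]_y \int[distribution P X]_x f (x, y).
Proof.
move=> XY mf f0.
have mXY : measurable_fun [set: T] (fun w => (X w, Y w)).
  by apply: measurable_fun_pair.
transitivity (\int[pushforward P (fun w => (X w, Y w))]_z f z).
  by rewrite ge0_integral_pushforward.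
rewrite -(@fubini_tonelli2 _ _ _ _ _ (distribution P X) (distribution P Y) f)//.
apply: eq_measure_integral => A mA _; apply/esym.
apply: (@product_measure_unique _ _ _ _ _ (distribution P X) (distribution P Y)
  (pushforward P (fun w => (X w, Y w)))) => //.
Qed.

Variables (n : nat) (S : 'M[R]_n) (m : R) (mu : 'cV[R]_n) (tau2 : R).
Variables (X : {RV P >-> n.-tuple R}) (V : {RV P >-> R}).
Hypothesis X_law : forall B : set (n.-tuple R), measurable B ->
  distribution P X B = mvnormal_dist mu S B.
Hypothesis V_law : forall B : set R, measurable B ->
  distribution P V B = pushforward (chi2_dist m) (fun x : R => (tau2 * x)%R) B.

Lemma chi2_distT : chi2_dist m [set: R] = 1.
Proof. transitivity (distribution P V [set: R]); first exact/esym/V_law.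
exact: probability_setT. Qed.

Lemma mvnormal_distT :
  \int[lebesgue_tuple R n]_x (mvnormal_pdf mu S x)%:E = 1.
Proof.
transitivity (distribution P X [set: n.-tuple R]); first exact/esym/X_law.
exact: probability_setT.
Qed.

Lemma ge0_integral_joint (f : n.-tuple R * R -> \bar R) :
  independent_rv X V -> measurable_fun [set: n.-tuple R * R] f -> (forall z, 0 <= f z) ->
  \int[P]_x f (X x, V x) =
  \int[L]_w \int[lebesgue_tuple R n]_x
    (f (x, (tau2 * w)%R) * (mvnormal_pdf mu S x * chi2_pdf m w)%:E).
Proof.
move=> XV mf f0.
have mtau : measurable_fun [set: R] (fun x : R => tau2 * x)%R by exact: measurable_funM.
rewrite ge0_integral_independent//.
pose g v := \int[lebesgue_tuple R n]_x (f (x, v) * (mvnormal_pdf mu S x)%:E).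
have mpdf := measurable_mvnormal_pdf mu S.
have mfpdf : measurable_fun [set: n.-tuple R * R] (fun z => f z * (mvnormal_pdf mu S z.1)%:E).
  by meas.
have fpdf0 z : 0 <= f z * (mvnormal_pdf mu S z.1)%:E.
  by rewrite mule_ge0// lee_fin mvnormal_pdf_ge0.
have mg : measurable_fun [set: R] g by exact: (measurable_fun_fubini_tonelli_G _ mfpdf).
have g0 v : 0 <= g v by apply: integral_ge0 => x _; exact: (fpdf0 (x, v)).
transitivity (\int[distribution P V]_v g v).
  apply: eq_integral => v _.
  apply: (@ge0_integral_density _ _ _ (distribution P X) (lebesgue_tuple R n)
    (mvnormal_pdf mu S) (fun x => f (x, v))) => //.
  - by move=> x; exact: mvnormal_pdf_ge0.
  - by meas.
transitivity (\int[pushforward (chi2_dist m) (fun x : R => (tau2 * x)%R)]_v g v).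
  by apply: eq_measure_integral => A mA _; exact: V_law.
rewrite ge0_integral_pushforward// preimage_setT.
rewrite (@ge0_integral_density _ _ _ (chi2_dist m) L (chi2_pdf m))//; last 4 first.
- exact: chi2_pdf_ge0.
- exact: chi2_distE.
- by apply: measurableT_comp.
- by move=> w; exact: g0.
apply: eq_integral => w _.
rewrite /= /g -ge0_integralZr//; last 2 first.
- by meas.
- by rewrite lee_fin chi2_pdf_ge0.
by apply: eq_integral => x _; rewrite -muleA -EFinM.
Qed.

End joint_law.

Section mvnormal_coordinate.
Context (R : realType) (n : nat) (S : 'M[R]_n.+1) (mu : 'cV[R]_n.+1) (i : 'I_n.+1).
Local Notation L := (@lebesgue_R R).
Hypothesis Sp : posdef S.
Let O := invmx S.
Let D : R := (Num.sqrt ((2 * pi) ^+ n.+1 * \det S))^-1.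

Let center (t : n.-tuple R) : 'cV[R]_n := \col_j (tnth t j - mu (lift i j) 0).

Lemma mvnormal_pdf_insert (y : R) (t : n.-tuple R) :
  mvnormal_pdf mu S (insert_tuple i y t) =
  expR (- quad O (insert_col i (y - mu i 0) (center t)) / 2) * D.
Proof.
rewrite /mvnormal_pdf; have -> : \col_k tnth (insert_tuple i y t) k - mu =
    insert_col i (y - mu i 0) (center t).
  apply/matrixP => k l; rewrite (ord1 l) [LHS]mxE [X in X + _]mxE [X in _ + X]mxE.
  case: (unliftP i k) => [j ->|->].
    by rewrite tnth_insert_lift insert_col_lift mxE.
  by rewrite tnth_insert_same insert_col_same.
by [].
Qed.

Let D0 : 0 <= D. Proof. by rewrite invr_ge0 sqrtr_ge0. Qed.
Let Oii : 0 < O i i. Proof. exact/posdef_diag_gt0/posdef_invmx. Qed.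
Let Sii : 0 < S i i. Proof. exact/posdef_diag_gt0. Qed.

Local Open Scope ereal_scope.

(** [c] collects the normalizing constant and the factor that depends on [t] alone. Both sides of
    the conditional comparison carry it, so only its sign matters there. [theta] is the conditional
    mean divided by the conditional standard deviation. *)
Lemma mvnormal_conditional (m : R) (t : n.-tuple R) : exists c theta : R,
  (0 <= c)%R /\ forall Phi : R * R -> R,
  measurable_fun [set: R * R] Phi -> (forall z, (0 <= Phi z)%R) ->
  \int[L]_w \int[L]_y (Phi (y * Num.sqrt (O i i), w) *
     mvnormal_pdf mu S (insert_tuple i y t) * chi2_pdf m w)%R%:E =
  c%:E * \int[L]_w \int[L]_u (Phi (u, w) * expR (- (u - theta) ^+ 2 / 2) *
    chi2_pdf m w)%R%:E.
Proof.
pose z := center t; pose b := ((O *m insert_col i 0 z) i 0)%R.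
pose r := Num.sqrt (O i i).
have r0 : (0 < r)%R by rewrite sqrtr_gt0.
pose rho := (quad O (insert_col i 0 z) - b ^+ 2 / O i i)%R.
pose theta := ((mu i 0 - b / O i i) * r)%R.
pose c := (expR (- rho / 2) * D)%R.
have c0 : (0 <= c)%R by rewrite mulr_ge0 ?expR_ge0.
exists (r^-1 * c)%R, theta; split; first by rewrite mulr_ge0 ?invr_ge0 ?(ltW r0).
move=> Phi mPhi Phi0.
have pdfE y : (mvnormal_pdf mu S (insert_tuple i y t) = c * expR (- (y * r - theta) ^+ 2 / 2))%R.
  rewrite mvnormal_pdf_insert quad_conditional// -/O -/z -/b -/rho /c mulrAC -expRD.
  congr (expR _ * _)%R.
  have -> : ((y * r - theta) ^+ 2 = O i i * (y - mu i 0 + b / O i i) ^+ 2)%R.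
    have rr : (r ^+ 2 = O i i)%R by rewrite sqr_sqrtr// ltW.
    by rewrite /theta -rr; ring.
  by ring.
pose F (u : R * R) := (Phi u * expR (- (u.1 - theta) ^+ 2 / 2) * chi2_pdf m u.2)%:E.
have mF : measurable_fun [set: R * R] F by unfold F; meas.
have F0 u : 0 <= F u by rewrite lee_fin !mulr_ge0 ?expR_ge0 ?chi2_pdf_ge0.
rewrite -ge0_integralZl//; last 3 first.
- exact: (measurable_fun_fubini_tonelli_G F).
- by move=> w _; apply: integral_ge0 => u _; exact: (F0 (u, w)).
- by rewrite lee_fin mulr_ge0 ?invr_ge0 ?(ltW r0).
apply: eq_integral => w _.
have mFw : measurable_fun [set: R] (fun u => F (u, w)) by meas.
have F0w u : 0 <= F (u, w) by [].
rewrite [X in _ = _ * X](ge0_integral_affine 0%R r0 mFw F0w).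
rewrite muleA -EFinM mulrAC mulVf ?gt_eqF// mul1r.
rewrite -ge0_integralZl ?lee_fin//; last by meas.
apply: eq_integral => y _; rewrite -EFinM pdfE /= addr0 (mulrC r).
by congr EFin; ring.
Qed.

Hypothesis pdfT : \int[lebesgue_tuple R n.+1]_x (mvnormal_pdf mu S x)%:E = 1.

Lemma mvnormal_marginal (g : R -> \bar R) :
  measurable_fun [set: R] g -> (forall y, 0 <= g y) ->
  \int[lebesgue_tuple R n.+1]_x (g (tnth x i - mu i 0)%R * (mvnormal_pdf mu S x)%:E) =
  \int[L]_u (g (Num.sqrt (S i i) * u)%R * (normal_pdf 0 1 u)%:E).
Proof.
pose E (t : n.-tuple R) := expR (- quad O (insert_col i 0 (\col_j tnth t j)) / 2).
have mE : measurable_fun [set: n.-tuple R] E.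
  apply: measurableT_comp => //; apply: measurable_funM => //; apply: measurableT_comp => //.
  apply: measurable_quad => k; case: (unliftP i k) => [j ->|->].
    rewrite (_ : (fun _ => _) = (fun x : n.-tuple R => tnth x j)).
      exact: measurable_tnth.
    by apply/funext => t; rewrite insert_col_lift mxE.
  rewrite (_ : (fun _ => _) = cst 0%R)//.
  by apply/funext => t; rewrite insert_col_same.
have E0 t : 0 <= (E t)%:E by rewrite lee_fin expR_ge0.
pose K := \int[lebesgue_tuple R n]_t (E t)%:E.
have K0 : 0 <= K by apply: integral_ge0.
(* For fixed [y], passing to the residual only translates [t], so translation invariance makes the
   integral over [t] independent of [y]. *)
pose sh y j : R := (- mu (lift i j) 0 - (y - mu i 0) / S i i * S (lift i j) i)%R.
have pdfE y t : (mvnormal_pdf mu S (insert_tuple i y t) =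
    expR (- (y - mu i 0) ^+ 2 / S i i / 2) * D * E (shift_tuple (sh y) t))%R.
  rewrite mvnormal_pdf_insert quad_marginal// -/O [RHS]mulrAC /E -expRD; congr (expR _ * _)%R.
  have -> : (center t - ((y - mu i 0) / S i i) *: row' i (col i S))%R =
      (\col_j tnth (shift_tuple (sh y) t) j)%R.
    by apply/matrixP => j l; rewrite !mxE tnth_mktuple /sh; ring.
  by ring.
pose s := Num.sqrt (S i i).
have s0 : (0 < s)%R by rewrite sqrtr_gt0.
have mpdf := measurable_mvnormal_pdf mu S.
move=> mg g0; have main f : measurable_fun [set: R] f -> (forall y, 0 <= f y) ->
  \int[lebesgue_tuple R n.+1]_x (f (tnth x i - mu i 0)%R * (mvnormal_pdf mu S x)%:E) =
  (s%:E * (D%:E * K)) * \int[L]_u (f (s * u)%R * (expR (- u ^+ 2 / 2))%:E).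
  move=> mf f0.
  have mti : measurable_fun [set: n.+1.-tuple R] (fun x : n.+1.-tuple R => tnth x i).
    exact: measurable_tnth.
  pose F x := f (tnth x i - mu i 0)%R * (mvnormal_pdf mu S x)%:E.
  have mF : measurable_fun [set: n.+1.-tuple R] F by unfold F; meas.
  have F0 x : 0 <= F x by rewrite mule_ge0// lee_fin mvnormal_pdf_ge0.
  rewrite (ge0_integral_insert i mF F0).
  pose F2 (z : R * n.-tuple R) := F (insert_tuple i z.1 z.2).
  have mF2 : measurable_fun [set: R * n.-tuple R] F2.
    by apply: measurableT_comp mF _; exact: measurable_insert_tuple.
  have F20 z : 0 <= F2 z by exact: F0.
  rewrite -(@fubini_tonelli _ _ _ _ _ L (lebesgue_tuple R n) F2)//.
  pose h y := f (y - mu i 0)%R * (expR (- (y - mu i 0) ^+ 2 / S i i / 2))%:E.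
  have mh : measurable_fun [set: R] h by unfold h; meas.
  have h0 y : 0 <= h y by rewrite mule_ge0// lee_fin expR_ge0.
  transitivity (\int[L]_y ((D%:E * K) * h y)).
    apply: eq_integral => y _.
    transitivity (\int[lebesgue_tuple R n]_t (D%:E * h y * (E (shift_tuple (sh y) t))%:E)).
      apply: eq_integral => t _; rewrite /F2 /F /= tnth_insert_same pdfE /h.
      by rewrite muleCA -muleA -!EFinM; congr (_ * _%:E); ring.
    rewrite ge0_integralZl//; last 2 first.
    - by apply/measurable_EFinP; apply: measurableT_comp mE _; exact: measurable_shift_tuple.
    - by rewrite mule_ge0.
    rewrite (@ge0_integral_shift_tuple _ _ _ (fun t => (E t)%:E))//; last exact/measurable_EFinP.
    by rewrite -/K muleAC.
  have DK0 : 0 <= D%:E * K by rewrite mule_ge0.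
  rewrite (ge0_integralZl L measurableT mh (fun y _ => h0 y) DK0).
  rewrite (ge0_integral_affine (mu i 0%R) s0 mh h0) muleA (muleC _ s%:E).
  congr (_ * _); apply: eq_integral => u _; rewrite /h addrK; congr (_ * (expR _)%:E).
  by rewrite exprMn sqr_sqrtr ?(ltW Sii)// -/O; field; rewrite gt_eqF.
(* Taking [f = 1] and total mass 1 identifies the constant without evaluating the determinant or
   [K]. *)
have A1 : s%:E * (D%:E * K) = (normal_peak (1 : R))%:E.
  have := main (cst 1) (measurable_cst _) (fun=> lee01).
  rewrite (eq_integral (fun x => (mvnormal_pdf mu S x)%:E)); last by move=> x _; rewrite mul1e.
  rewrite pdfT (eq_integral (fun u : R => (expR (- u ^+ 2 / 2))%:E)); last by move=> x _; rewrite mul1e.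
  rewrite integral_gauss_half => /(congr1 (fun x => x * (normal_peak (1 : R))%:E)).
  rewrite mul1e -muleA -EFinM mulVf ?mule1// gt_eqF// normal_peak_gt0// oner_neq0//.
rewrite main// A1 -ge0_integralZl//; last 3 first.
- by meas.
- by move=> u _; rewrite mule_ge0// lee_fin expR_ge0.
- by rewrite lee_fin normal_peak_ge0.
apply: eq_integral => u _.
by rewrite normal_pdfE ?oner_neq0// /normal_fun subr0 expr1n muleCA EFinM.
Qed.

End mvnormal_coordinate.

(** * Control of the false discovery rate *)

Section expected_weight.
Context (R : realType) (n : nat) (S : 'M[R]_n.+1) (m : R) (mu : 'cV[R]_n.+1).
Context (i : 'I_n.+1) (q : R -> R) (a : R).
Local Notation L := (@lebesgue_R R).
Local Notation nu := (student_dist m).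
Hypothesis Sp : posdef S.
Hypothesis m0 : 0 < m.
Hypothesis chi2T : chi2_dist m [set: R] = 1%E.
Hypothesis pdfT : (\int[lebesgue_tuple R n.+1]_x (mvnormal_pdf mu S x)%:E)%E = 1%E.
Hypothesis qE : forall x : R, (q x)%:E = nu [set b | x <= m * b ^+ 2].
Hypothesis qa : nu [set b | q (m * b ^+ 2) <= a] = a%:E.
Hypothesis a0 : 0 < a.
Hypothesis mui : mu i 0 = 0.
Let O := invmx S.
Let Ojj j : 0 < O j j. Proof. exact/posdef_diag_gt0/posdef_invmx. Qed.
(** [S] stands for [tau2 *: Sigma] and [w] for [V / tau2], so the unknown scale cancels between
    [O j j] and [w]. *)
Let pv (x : n.+1.-tuple R) (w : R) (j : 'I_n.+1) := q (m * tnth x j ^+ 2 * O j j / w).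
Let rej (x : n.+1.-tuple R) (w : R) : R := if pv x w i <= a then 1 else 0.
Let mq : measurable_fun [set: R] q := measurable_pvalue qE.

Let measurable_pv j : measurable_fun [set: n.+1.-tuple R * R] (fun z => pv z.1 z.2 j).
Proof.
have mt : measurable_fun [set: n.+1.-tuple R * R] (fun z => tnth z.1 j).
  exact: (measurableT_comp (measurable_tnth j) measurable_fst).
by apply: (measurableT_comp mq); meas.
Qed.

Let measurable_loo : measurable_fun [set: n.+1.-tuple R * R]
  (fun z => loo_weight a (pv z.1 z.2) i).
Proof.
by apply: (@measurable_loo_weight _ _ R n.+1 a (fun j z => pv z.1 z.2 j) i).
Qed.

Let measurable_rej : measurable_fun [set: n.+1.-tuple R * R] (fun z => rej z.1 z.2).
Proof.
by apply: measurable_fun_ifT => //; apply: measurable_fun_ler.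
Qed.

Let measurable_insert (t : n.-tuple R) : measurable_fun [set: R * R]
  (fun z => (insert_tuple i (z.1 / Num.sqrt (O i i)) t, z.2)).
Proof.
apply: measurable_fun_pair => //.
apply: (@measurableT_comp _ _ _ _ _ _ (fun z : R * n.-tuple R => insert_tuple i z.1 z.2)
  _ (fun z : R * R => (z.1 / Num.sqrt (O i i), t))).
  exact: measurable_insert_tuple.
by apply: measurable_fun_pair => //; apply: measurable_funM.
Qed.

Let sO0 : 0 < Num.sqrt (O i i). Proof. by rewrite sqrtr_gt0. Qed.

Let pv_insert t u w :
  pv (insert_tuple i (u / Num.sqrt (O i i)) t) w i = q (m * u ^+ 2 / w).
Proof.
rewrite /pv tnth_insert_same expr_div_n sqr_sqrtr ?ltW//; congr (q (_ / w)).
by field; rewrite gt_eqF.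
Qed.

Local Open Scope ereal_scope.

Lemma conditional_loo_weight_le (t : n.-tuple R) :
  \int[L]_w \int[L]_y (loo_weight a (pv (insert_tuple i y t) w) i *
     mvnormal_pdf mu S (insert_tuple i y t) * chi2_pdf m w)%R%:E <=
  \int[L]_w \int[L]_y (rej (insert_tuple i y t) w *
     mvnormal_pdf mu S (insert_tuple i y t) * chi2_pdf m w)%R%:E.
Proof.
have [c [theta [c0 cond]]] := @mvnormal_conditional R n S mu i Sp m t.
pose ins u := insert_tuple i (u / Num.sqrt (O i i)) t.
(* The leave-one-out count ignores coordinate [i], so any value may be inserted there. Taking 0
   makes [r] visibly a function of [w] alone. *)
pose r (w : R) := loo_index a (pv (ins 0%R) w) i.
have looE u w : loo_weight a (pv (ins u) w) i =
    if (q (m * u ^+ 2 / w) <= (r w)%:R * a)%R then (r w)%:R^-1%R else 0%R.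
  rewrite /loo_weight pv_insert.
  suff -> : loo_index a (pv (ins u) w) i = r w by [].
  have E j : j != i -> pv (ins u) w j = pv (ins 0%R) w j.
    case: (unliftP i j) => [k ->|->]; last by rewrite eqxx.
    by rewrite /pv !tnth_insert_lift.
  by apply/eqP; rewrite eqn_leq !loo_index_anti// => j /E ->.
have mloo : measurable_fun [set: R * R] (fun z => loo_weight a (pv (ins z.1) z.2) i).
  exact: (measurableT_comp measurable_loo (measurable_insert t)).
have mrej : measurable_fun [set: R * R] (fun z => rej (ins z.1) z.2).
  exact: (measurableT_comp measurable_rej (measurable_insert t)).
have insE y : ins (y * Num.sqrt (O i i))%R = insert_tuple i y t.
  by rewrite /ins mulfK// gt_eqF.
have -> : \int[L]_w \int[L]_y (loo_weight a (pv (insert_tuple i y t) w) i *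
     mvnormal_pdf mu S (insert_tuple i y t) * chi2_pdf m w)%R%:E =
  c%:E * \int[L]_w \int[L]_u
    ((if (q (m * u ^+ 2 / w) <= (r w)%:R * a)%R then (r w)%:R^-1%R else 0%R)
     * expR (- (u - theta) ^+ 2 / 2) * chi2_pdf m w)%R%:E.
  transitivity (c%:E * \int[L]_w \int[L]_u (loo_weight a (pv (ins u) w) i
     * expR (- (u - theta) ^+ 2 / 2) * chi2_pdf m w)%R%:E).
    rewrite -(cond (fun z => loo_weight a (pv (ins z.1) z.2) i) mloo); last first.
      by move=> z; exact: loo_weight_ge0.
    by apply: eq_integral => w _; apply: eq_integral => y _ /=; rewrite insE.
  by apply: congr1; apply: eq_integral => w _; apply: eq_integral => y _; rewrite looE.
have -> : \int[L]_w \int[L]_y (rej (insert_tuple i y t) w *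
     mvnormal_pdf mu S (insert_tuple i y t) * chi2_pdf m w)%R%:E =
  c%:E * \int[L]_w \int[L]_u ((if (q (m * u ^+ 2 / w) <= a)%R then 1%R else 0%R)
     * expR (- (u - theta) ^+ 2 / 2) * chi2_pdf m w)%R%:E.
  transitivity (c%:E * \int[L]_w \int[L]_u (rej (ins u) w
     * expR (- (u - theta) ^+ 2 / 2) * chi2_pdf m w)%R%:E).
    rewrite -(cond (fun z => rej (ins z.1) z.2) mrej); last first.
      by move=> z; rewrite /rej; case: ifP.
    by apply: eq_integral => w _; apply: eq_integral => y _ /=; rewrite insE.
  apply: congr1; apply: eq_integral => w _; apply: eq_integral => y _.
  by rewrite /rej pv_insert.
apply: lee_wpmul2l; first by rewrite lee_fin.
apply: conditional_stepup_le => //.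
- by move=> w; exact: loo_index_gt0.
- move=> v w /andP[v0 vw]; apply: loo_index_anti => j _; apply: (le_pvalue qE).
  have w0 : (0 < w)%R := lt_le_trans v0 vw.
  rewrite ler_wpM2l ?lef_pV2//.
  exact: (mulr_ge0 (mulr_ge0 (ltW m0) (sqr_ge0 _)) (ltW (Ojj j))).
- rewrite (_ : (fun _ => _) = (fun z => loo_weight a (pv (ins z.1) z.2) i))//.
  by apply/funext => z; rewrite looE.
Qed.

Lemma swap_insert (g : n.+1.-tuple R * R -> R) :
  measurable_fun [set: n.+1.-tuple R * R] g -> (forall z, (0 <= g z)%R) ->
  \int[L]_w \int[lebesgue_tuple R n.+1]_x
    (g (x, w) * mvnormal_pdf mu S x * chi2_pdf m w)%R%:E =
  \int[lebesgue_tuple R n]_t \int[L]_w \int[L]_y (g (insert_tuple i y t, w) *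
     mvnormal_pdf mu S (insert_tuple i y t) * chi2_pdf m w)%R%:E.
Proof.
move=> mg g0.
have mpdf := measurable_mvnormal_pdf mu S.
pose F (z : n.+1.-tuple R * R) := (g z * mvnormal_pdf mu S z.1 * chi2_pdf m z.2)%:E.
have mF : measurable_fun [set: n.+1.-tuple R * R] F by unfold F; meas.
have F0 z : 0 <= F z.
  by rewrite lee_fin !mulr_ge0 ?mvnormal_pdf_ge0 ?chi2_pdf_ge0.
pose F3 (z : (R * n.-tuple R) * R) := F (insert_tuple i z.1.1 z.1.2, z.2).
have mF3 : measurable_fun [set: (R * n.-tuple R) * R] F3.
  apply: measurableT_comp mF _; apply: measurable_fun_pair => //.
  exact: (measurableT_comp (@measurable_insert_tuple R n i) measurable_fst).
pose G (z : R * n.-tuple R) := \int[L]_y F3 ((y, z.2), z.1).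
have mG : measurable_fun [set: R * n.-tuple R] G.
  pose F4 (z : (R * n.-tuple R) * R) := F3 ((z.2, z.1.2), z.1.1).
  have mF4 : measurable_fun [set: (R * n.-tuple R) * R] F4.
    apply: measurableT_comp mF3 _; meas.
  have F40 z : 0 <= F4 z by exact: F0.
  exact: (@measurable_fun_fubini_tonelli_F _ _ _ _ _ L F4 mF4 F40).
have G0 z : 0 <= G z by apply: integral_ge0 => y _; exact: F0.
transitivity (\int[L]_w \int[lebesgue_tuple R n]_t G (w, t)).
  apply: eq_integral => w _.
  have mFw : measurable_fun [set: n.+1.-tuple R] (fun x => F (x, w)).
    by apply: measurableT_comp mF _; meas.
  by rewrite (ge0_integral_insert i mFw (fun x => F0 (x, w))).
by rewrite (@fubini_tonelli _ _ _ _ _ L (lebesgue_tuple R n) G).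
Qed.

(** Integrating over [t] restores the unconditional law of coordinate [i], centered by [mui] and
    with variance [S i i], whereas [pv] standardizes by the conditional variance [(O i i)^-1]. The
    factor [S i i * O i i] measures this mismatch. *)
Lemma expected_loo_weight_le :
  \int[L]_w \int[lebesgue_tuple R n.+1]_x
    (loo_weight a (pv x w) i * mvnormal_pdf mu S x * chi2_pdf m w)%R%:E <=
  nu [set b | (q (m * (S i i * O i i) * b ^+ 2) <= a)%R].
Proof.
have mpdf := measurable_mvnormal_pdf mu S.
have Sii : (0 < S i i)%R by exact: posdef_diag_gt0.
rewrite (@swap_insert (fun z => loo_weight a (pv z.1 z.2) i))//; last first.
  by move=> z; exact: loo_weight_ge0.
apply: (@le_trans _ _ (\int[lebesgue_tuple R n]_t \int[L]_w \int[L]_y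
    (rej (insert_tuple i y t) w *
     mvnormal_pdf mu S (insert_tuple i y t) * chi2_pdf m w)%R%:E)).
  apply: ge0_le_integral_nonmeas => t; last exact: conditional_loo_weight_le.
  apply: integral_ge0 => w _; apply: integral_ge0 => y _.
  by rewrite lee_fin !mulr_ge0 ?mvnormal_pdf_ge0 ?chi2_pdf_ge0// loo_weight_ge0.
have rej0 z : (0 <= rej z.1 z.2)%R by rewrite /rej; case: ifP.
rewrite -(@swap_insert (fun z => rej z.1 z.2))//.
pose A := [set b | (q (m * (S i i * O i i) * b ^+ 2) <= a)%R].
have mqA : measurable_fun [set: R] (fun b => q (m * (S i i * O i i) * b ^+ 2)%R <= a)%R.
  by apply: measurable_fun_ler => //; apply: (measurableT_comp mq); meas.
have mA : measurable A by rewrite -[A]setTI; exact: mqA.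
have -> : nu A = \int[nu]_b (\1_A b)%:E by rewrite integral_indic// setIT.
rewrite -ge0_integral_tstat//; last by apply/measurable_EFinP; exact: measurable_indic.
rewrite le_eqVlt; apply/orP; left; apply/eqP/eq_integral => w _.
pose g y := ((if (q (m * y ^+ 2 * O i i / w) <= a)%R then 1 else 0) * chi2_pdf m w)%R%:E.
have mg : measurable_fun [set: R] g.
  apply/measurable_EFinP; apply: measurable_funM => //.
  apply: measurable_fun_ifT => //; apply: measurable_fun_ler => //.
  by apply: (measurableT_comp mq); meas.
have g0 y : 0 <= g y by rewrite lee_fin mulr_ge0 ?chi2_pdf_ge0//; case: ifP.
transitivity (\int[lebesgue_tuple R n.+1]_x
    (g (tnth x i - mu i 0%R)%R * (mvnormal_pdf mu S x)%:E)).
  by apply: eq_integral => x _; rewrite mui subr0 /g -EFinM mulrAC.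
rewrite mvnormal_marginal//; apply: eq_integral => u _.
rewrite /g -!EFinM indicE; congr EFin.
have [w0|w0] := leP w 0%R; first by rewrite /chi2_pdf ltNge w0 /= !mulr0 mul0r.
rewrite [RHS]mulrA [LHS]mulrAC; congr (_ * _ * _)%R.
have -> : ((u / Num.sqrt w)%R \in A) =
    (q (m * (Num.sqrt (S i i) * u) ^+ 2 * O i i / w) <= a)%R; last by case: ifP.
have -> : (m * (Num.sqrt (S i i) * u) ^+ 2 * O i i / w =
    m * (S i i * O i i) * (u / Num.sqrt w) ^+ 2)%R.
  rewrite exprMn expr_div_n !sqr_sqrtr ?ltW//.
  by field; rewrite gt_eqF.
by apply/idP/idP => [/set_mem|H]; [|apply/mem_set].
Qed.

End expected_weight.

Section stepup_fdr.
Context (R : realType) (dT : measure_display) (T : measurableType dT)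
  (P : probability T R) (n : nat) (Sigma : 'M[R]_n.+1) (m : R)
  (mu : 'cV[R]_n.+1) (tau2 : R) (X : {RV P >-> n.+1.-tuple R}) (V : {RV P >-> R}).
Context (alpha a : R) (q : R -> R).
Local Notation nu := (student_dist m).
Local Notation q_inv := ('pinv_(fun=> 0) `]0, +oo[ q).
Hypothesis Sp : posdef Sigma.
Hypothesis m0 : 0 < m.
Hypothesis tau0 : 0 < tau2.
Hypothesis X_law : forall B : set (n.+1.-tuple R), measurable B ->
  distribution P X B = mvnormal_dist mu (tau2 *: Sigma) B.
Hypothesis V_law : forall B : set R, measurable B ->
  distribution P V B = pushforward (chi2_dist m) (fun x : R => tau2 * x) B.
Hypothesis XV : independent_rv X V.
Hypothesis alpha1 : alpha < 1.
Hypothesis a0 : 0 < a.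
Hypothesis qE : forall x : R, (q x)%:E = nu [set b | x <= m * b ^+ 2].
Let w i := 1 - multiple_corr2 Sigma i.
Hypothesis sumE : \sum_i q (w i * q_inv a) = alpha.

Let O := invmx Sigma.
Let chi2T : chi2_dist m [set: R] = 1%E. Proof. exact: chi2_distT V_law. Qed.
Let Sii i : 0 < Sigma i i. Proof. exact: posdef_diag_gt0. Qed.
Let Oii i : 0 < O i i. Proof. exact/posdef_diag_gt0/posdef_invmx. Qed.
Let wE i : (w i)^-1 = O i i * Sigma i i.
Proof.
have := posdef_multiple_corr2 i Sp; rewrite -/O -/(w i) => e.
by apply: (mulIf (_ : w i != 0)); rewrite ?e ?mulVf//;
   apply: contra_eq_neq e => ->; rewrite mulr0 eq_sym oner_neq0.
Qed.
Let w0 i : 0 < w i. Proof. by rewrite -invr_gt0 wE mulr_gt0. Qed.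

(* For [v <= 0] the junk values of [Num.sqrt] and division make both sides [1]. *)
Lemma adjusted_pvalueE (x v : R) (i : 'I_n.+1) :
  q ((w i)^-1 * q_inv (q ((Num.sqrt m * (x / Num.sqrt (Sigma i i)) / Num.sqrt v) ^+ 2))) =
  q (m * x ^+ 2 * O i i / v).
Proof.
rewrite (pvalue_inv_pvalue chi2T m0 qE) max_r ?sqr_ge0//.
have [v0|v0] := leP v 0.
  rewrite (ler0_sqrtr v0) invr0 mulr0 expr0n mulr0 !(pvalue_le0 chi2T m0 qE)//.
  rewrite mulr_ge0_le0 ?invr_le0//.
  exact: (mulr_ge0 (mulr_ge0 (ltW m0) (sqr_ge0 _)) (ltW (Oii i))).
congr q; rewrite wE !(exprMn, exprVn) !sqr_sqrtr ?ltW//.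
by field; rewrite !gt_eqF.
Qed.

(* If [a] were outside the image of [q], the junk value [q_inv a = 0] would make
   every summand [q 0 = 1], against [alpha < 1]. *)
Lemma pvalue_inv_gt0 : 0 < q_inv a /\ q (q_inv a) = a.
Proof.
have [c0|//] := pvalue_inv_dichotomy chi2T m0 qE a; exfalso.
move: sumE alpha1; rewrite c0; under eq_bigr do rewrite mulr0 (pvalue_le0 chi2T m0 qE)//.
rewrite sumr_const card_ord => <-.
by rewrite ltNge ler1n.
Qed.

Lemma student_dist_scaled i :
  nu [set b | q (m * (Sigma i i * O i i) * b ^+ 2) <= a] = (q (w i * q_inv a))%:E.
Proof.
have [c0 qc] := pvalue_inv_gt0; rewrite qE; congr (nu _).
apply/seteqP; split => b /=.
- move=> h; rewrite leNgt; apply/negP => bc; move: h; apply/negP; rewrite -ltNge -qc.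
  apply: (lt_pvalue chi2T m0 qE); rewrite mulr_ge0 ?sqr_ge0 ?mulr_ge0 ?ltW//=.
  by rewrite mulrAC (mulrC (Sigma i i)) -wE ltr_pdivrMr// (mulrC (q_inv a)).
- move=> h; rewrite -qc; apply: (le_pvalue qE).
  by rewrite mulrAC (mulrC (Sigma i i)) -wE ler_pdivlMr// (mulrC (q_inv a)).
Qed.

Local Open Scope ereal_scope.

Lemma stepup_fdr_le :
  FDR P (finset (fun i => mu i 0%R == 0%R))
    (fun omega => stepup_reject (fun k : nat => k%:R * a)%R (fun i =>
      q ((w i)^-1 * q_inv (q ((Num.sqrt m *
        (tnth (X omega) i / Num.sqrt (Sigma i i)) / Num.sqrt (V omega)) ^+ 2)))%R)) <=
  alpha%:E.
Proof.
set H0 := finset _.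
pose pt (x : n.+1.-tuple R) (v : R) j := q (m * tnth x j ^+ 2 * O j j / v)%R.
have mq := measurable_pvalue qE.
have mpt j : measurable_fun [set: n.+1.-tuple R * R] (fun z => pt z.1 z.2 j).
  have mt : measurable_fun [set: n.+1.-tuple R * R] (fun z => tnth z.1 j).
    exact: (measurableT_comp (measurable_tnth j) measurable_fst).
  by apply: (measurableT_comp mq); meas.
pose f i (z : n.+1.-tuple R * R) := (loo_weight a (pt z.1 z.2) i)%:E.
have mf i : measurable_fun [set: n.+1.-tuple R * R] (f i).
  apply/measurable_EFinP.
  by apply: (@measurable_loo_weight _ _ R n.+1 a (fun j z => pt z.1 z.2 j) i).
have f0 i z : 0 <= f i z by rewrite lee_fin loo_weight_ge0.
have mfXV i : measurable_fun [set: T] (fun omega => f i (X omega, V omega)).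
  by apply: (measurableT_comp (mf i)); apply: measurable_fun_pair.
have [c0 qc] := pvalue_inv_gt0.
have expect i : i \in H0 ->
    \int[P]_omega f i (X omega, V omega) <= (q (w i * q_inv a))%:E.
  rewrite inE => /eqP mui.
  have SpT : posdef (tau2 *: Sigma)%R by exact: posdefZ.
  have OT j : invmx (tau2 *: Sigma)%R j j = (tau2^-1 * O j j)%R.
    by rewrite invmxZ ?mxE// posdef_unitmx.
  rewrite (ge0_integral_joint X_law V_law XV (mf i) (f0 i)) -student_dist_scaled.
  have := @expected_loo_weight_le R n (tau2 *: Sigma)%R m mu i q a SpT m0 chi2T
    (mvnormal_distT X_law) qE (student_dist_pvalue_eq chi2T m0 qE c0 qc) a0 mui.
  rewrite OT mxE => le; apply: (le_trans _ (le_trans le _)); last first.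
    by rewrite (_ : tau2 * Sigma i i * (tau2^-1 * O i i) = Sigma i i * O i i)%R//;
      field; rewrite gt_eqF.
  rewrite le_eqVlt; apply/orP; left; apply/eqP.
  apply: eq_integral => v _; apply: eq_integral => x _.
  rewrite /f -EFinM mulrA /pt; congr (loo_weight a _ i * _ * _)%R%:E.
  by apply/funext => j /=; rewrite OT; congr q; rewrite invfM; ring.
apply: (@le_trans _ _ (\sum_(i in H0) \int[P]_omega f i (X omega, V omega))).
  rewrite -big_filter -ge0_integral_sum//.
  rewrite /FDR unlock; apply: ge0_le_integral_nonmeas => omega.
    by rewrite lee_fin divr_ge0.
  rewrite big_filter /f sumEFin lee_fin; apply: fdp_le; first exact: ltW.
  by congr stepup_reject; apply/funext => i; rewrite adjusted_pvalueE.
apply: (@le_trans _ _ (\sum_(i in H0) (q (w i * q_inv a))%:E)).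
  exact: lee_sum.
(* The terms of the false nulls are nonnegative, so the sum over true nulls is at most the full sum
   [alpha], whatever [mu] is. *)
rewrite sumEFin lee_fin -sumE [leRHS](bigID (mem H0))/= lerDl.
by apply: sumr_ge0 => i _; exact: (pvalue_ge0 qE).
Qed.

End stepup_fdr.

Theorem theorem2 (R : realType) (dT : measure_display) (T : measurableType dT)
    (P : probability T R) (d : nat) (Sigma : 'M[R]_d) (m : R)
    (mu : 'cV[R]_d) (tau2 : R)
    (X : {RV P >-> d.-tuple R}) (V : {RV P >-> R}) (alpha alpha1 : R) :
  (1 <= d)%N -> posdef Sigma -> 0 < m -> 0 < tau2 ->
  (forall B : set (d.-tuple R), measurable B ->
     distribution P X B = mvnormal_dist mu (tau2 *: Sigma) B) ->
  (forall B : set R, measurable B ->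
     distribution P V B = pushforward (chi2_dist m) (fun x : R => tau2 * x) B) ->
  independent_rv X V ->
  let Z (i : 'I_d) (omega : T) := tnth (X omega) i / Num.sqrt (Sigma i i) in
  let t (i : 'I_d) (omega : T) := Num.sqrt m * Z i omega / Num.sqrt (V omega) in
  let p (i : 'I_d) (omega : T) := Psibar 1 m (t i omega ^+ 2) in
  let w (i : 'I_d) := 1 - multiple_corr2 Sigma i in
  let ptilde (i : 'I_d) (omega : T) :=
    Psibar 1 m ((w i)^-1 * Psibar_inv 1 m (p i omega)) in
  0 < alpha < 1 -> 0 < alpha1 < 1 ->
  \sum_(i < d) Psibar 1 m (w i * Psibar_inv 1 m alpha1) = alpha ->
  let H0 : {set 'I_d} := finset (fun i => mu i 0 == 0) in
  let reject (omega : T) : {set 'I_d} :=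
    stepup_reject (fun k : nat => k%:R * alpha1) (fun i => ptilde i omega) in
  (FDR P H0 reject <= alpha%:E)%E.

Proof.
case: d Sigma mu X => [//|n] Sigma mu X _ Sp m0 tau0 X_law V_law XV.
have qE := PsibarE (chi2_distT V_law) m0.
(* From here on the p-value function is abstract and known only through its tail formula [qE]. *)
rewrite /Psibar_inv; move: (Psibar 1 m) qE => q qE.
move=> /andP[_ alpha_lt1] /andP[alpha1_gt0 _] sumE.
exact: (stepup_fdr_le Sp m0 tau0 X_law V_law XV alpha_lt1 alpha1_gt0 qE sumE).
Qed.
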